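(* Let $A\in\mathbb{R}^{m\times n}$ ($m<n$) and $M\in\mathbb{R}^{m\times q}$ ($m\le q$) with $\mathrm{rank}(A)=\mathrm{rank}(M)=m$, let $y\in\mathbb{R}^m$ and $\mu>0$ be given, and let $\phi$ be a norm on $\mathbb{R}^q$ with $\phi(\mathbf e_i)=\phi^*(\mathbf e_i)=1$ for $i=1,\dots,q$. Consider the problem $$(\mathrm{L})\qquad\min_x\{\phi(M^T(Ax-y)):\ \|x\|_1\le\mu\}.$$ Let $\delta>0$ be any fixed sufficiently small constant, and let $\mathcal Q_{\epsilon_{j_0}}$ be a fixed polytope from the family $\{\mathcal Q_{\epsilon_j}\}$ defined in the context such that $d^{\mathcal H}(\Lambda^*,\Lambda_{\epsilon_{j_0}})\le\delta$. Suppose that $A^T$ satisfies the weak RSP of order $k$. Then for any $x\in\mathbb{R}^n$ there is an optimal solution $x^*$ of $(\mathrm{L})$ with $$\|x-x^*\|_2\le\delta+2\widehat\gamma\left[(\|x\|_1-\mu)^++2\phi(M^T(Ax-y))+\frac{|\mu-\|x\|_1|+2\sigma_k(x)_1}{c}\right],$$ where $$c=\max_{G\subseteq\{1,\dots,q\},\,|G|=m}\{\|M_G^{-1}(AA^T)^{-1}A\|_{\infty\to1}:\ M_G\in\mathbb{R}^{m\times m}\text{ is an invertible submatrix of }M\},$$ and $\widehat\gamma=\sigma_{\infty,2}(\widehat M^1,\widehat M^2)$ is the Robinson's constant of the pair $(\widehat M^1,\widehat M^2)$ defined in the context. Moreover, for any $x$ with $\|x\|_1\le\mu$ there is an optimal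 solution $x^*$ of $(\mathrm{L})$ with $$\|x-x^*\|_2\le\delta+2\widehat\gamma\left[2\phi(M^T(Ax-y))+\frac{|\mu-\|x\|_1|+2\sigma_k(x)_1}{c}\right].$$
   Context: Notation: $\mathbf e_i$ are the standard basis vectors of $\mathbb{R}^q$; $\phi^*(u)=\max_{\phi(x)\le1}u^Tx$ is the dual norm; $(s)^+=\max\{s,0\}$; $\sigma_k(x)_1=\inf_u\{\|x-u\|_1:\|u\|_0\le k\}$, where $\|u\|_0$ is the number of nonzero entries; $M_G$ is the submatrix of $M$ consisting of columns indexed by $G$; $\|Q\|_{\infty\to1}=\max_{\|x\|_\infty\le1}\|Qx\|_1$; $d^{\mathcal H}(\Omega_1,\Omega_2)=\max\{\sup_{u\in\Omega_1}\inf_{z\in\Omega_2}\|u-z\|_2,\ \sup_{z\in\Omega_2}\inf_{u\in\Omega_1}\|u-z\|_2\}$ is the Hausdorff distance. Weak RSP of order $k$ of $A^T$: for any disjoint $S_1,S_2\subseteq\{1,\dots,n\}$ with $|S_1|+|S_2|\le k$ there exists $\zeta\in\mathcal{R}(A^T)$ (the range of $A^T$) with $\zeta_i=1$ for $i\in S_1$, $\zeta_i=-1$ for $i\in S_2$, and $|\zeta_i|\le1$ for $i\notin S_1\cup S_2$. Polytopes $\mathcal Q_{\epsilon_j}$: let $\mathfrak B^\phi=\{x\in\mathbb{R}^q:\phi(x)\le1\}$. Fix $\chi>e/(4\sqrt2)$. By a theorem of Barvinok there is $\epsilon_0=\epsilon_0(\chi)>0$ such that for each $0<\epsilon<\epsilon_0$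 there is a symmetric polytope $P_\epsilon\subset\mathbb{R}^q$ with at most $\left(\frac{\chi}{\sqrt\epsilon}\ln\frac1\epsilon\right)^q$ vertices and $P_\epsilon\subseteq\mathfrak B^\phi\subseteq(1+\epsilon)P_\epsilon$; fix such $P_\epsilon$. Shifting each facet hyperplane of $(1+\epsilon)P_\epsilon$ in parallel toward $\mathfrak B^\phi$ until it touches $\mathfrak B^\phi$ gives a polytope $\widehat P_\epsilon=\bigcap_{i=1}^J\{x:(a^i)^Tx\le1\}$, where the $a^i$ are the outer facet normals of $(1+\epsilon)P_\epsilon$ scaled so that $\phi^*(a^i)=1$. Put $\overline P_\epsilon=\widehat P_\epsilon\cap\{z\in\mathbb{R}^q:\ \mathbf e_i^Tz\le1,\ -\mathbf e_i^Tz\le1,\ i=1,\dots,q\}$. Fix a strictly decreasing positive sequence $\epsilon_k\in(0,\epsilon_0)$ with $\epsilon_k\to0$, and set $\mathcal Q_{\epsilon_j}=\bigcap_{k=1}^j\overline P_{\epsilon_k}$. Then $P_{\epsilon_j}\subseteq\mathfrak B^\phi\subseteq\mathcal Q_{\epsilon_j}\subseteq(1+\epsilon_j)P_{\epsilon_j}$. Let $\mathcal Y(\Gamma_{\mathcal Q_{\epsilon_j}})$ be the finite set of all vectors $a$ (each with $\phi^*(a)=1$) defining the half-spaces $a^Tz\le1$ in this construction of $\mathcal Q_{\epsilon_j}$ (including $\pm\mathbf e_i$), and $\Gamma_{\mathcal Q_{\epsilon_j}}$ the matrix with these vectors as columns, so that $\mathcal Q_{\epsilon_j}=\{z:(\Gamma_{\mathcal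 Q_{\epsilon_j}})^Tz\le\text{vector of ones}\}$. Solution set and relaxations: let $\rho^*$ be the optimal value of $(\mathrm L)$, $\Lambda^*=\{x\in\mathbb{R}^n:\|x\|_1\le\mu,\ \phi(M^T(Ax-y))\le\rho^*\}$ its set of optimal solutions, and $\Lambda_{\epsilon_j}=\{x\in\mathbb{R}^n:\|x\|_1\le\mu,\ a^TM^T(Ax-y)\le\rho^*\text{ for all }a\in\mathcal Y(\Gamma_{\mathcal Q_{\epsilon_j}})\}$. (One has $d^{\mathcal H}(\Lambda^*,\Lambda_{\epsilon_j})\to0$ as $j\to\infty$, so a $j_0$ as required exists.) Robinson's constant: for $M'\in\mathbb{R}^{p_1\times r}$, $M''\in\mathbb{R}^{p_2\times r}$ let $$\mu_{\alpha_1,\alpha_2}(M',M'')=\max_{(d',d'')\in\mathcal F,\ \|(d',d'')\|_{\alpha_2}\le1}\ \min_{u\in\mathbb{R}^r}\{\|u\|_{\alpha_1}:\ M'u\le d',\ M''u=d''\},$$ with $\mathcal F=\{(d',d''):\ M'u\le d',\ M''u=d''\text{ for some }u\in\mathbb{R}^r\}$ (this is a finite number). For $N^1\in\mathbb{R}^{m_1\times\ell}$, $N^2\in\mathbb{R}^{m_2\times\ell}$, $$\sigma_{\alpha_1,\alpha_2}(N^1,N^2)=\max_{S\subseteq\{1,\dots,m_1\}}\mu_{\alpha_1,\alpha_2}\left(\begin{bmatrix}I_S&0\\-I&0\end{bmatrix},\begin{bmatrix}N^1\\N^2\end{bmatrix}^T\right),$$ where $I$ is the $m_1\times m_1$ identity,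 $I_S$ consists of the rows of $I$ indexed by $S$, and the first matrix has $m_1+m_2$ columns. The matrices $\widehat M^1,\widehat M^2$: write $\Gamma=\Gamma_{\mathcal Q_{\epsilon_{j_0}}}\in\mathbb{R}^{q\times\widehat n}$, $\widehat n$ being its number of columns; $\widetilde{\mathbf e}\in\mathbb{R}^n$, $\widehat{\mathbf e}\in\mathbb{R}^{\widehat n}$ are vectors of ones, $I$ is the $n\times n$ and $\widehat I$ the $\widehat n\times\widehat n$ identity; block columns have sizes $n,n,1,n,n,1,\widehat n$: $$\widehat M^1=\begin{bmatrix} I&-I&0&0&0&0&0\\ -I&-I&0&0&0&0&0\\ 0&\widetilde{\mathbf e}^T&0&0&0&0&0\\ (M\Gamma)^TA&0&-\widehat{\mathbf e}&0&0&0&0\\ 0&0&0&I&I&-\widetilde{\mathbf e}&0\\ 0&0&0&0&0&0&\widehat{\mathbf e}^T\\ 0&-I&0&0&0&0&0\\ 0&0&-1&0&0&0&0\\ 0&0&0&-I&0&0&0\\ 0&0&0&0&-I&0&0\\ 0&0&0&0&0&-1&0\\ 0&0&0&0&0&0&-\widehat I \end{bmatrix},\qquad \widehat M^2=\begin{bmatrix} 0&0&0&I&-I&0&A^TM\Gamma\\ 0&0&1&0&0&\mu&y^TM\Gamma \end{bmatrix}.$$ *)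

(* Defs.v *)
From HB Require Import structures.
From mathcomp Require Import all_boot all_order all_algebra.
From mathcomp Require Import all_classical all_reals all_analysis.

Set Implicit Arguments.
Unset Strict Implicit.
Unset Printing Implicit Defensive.

Import Order.TTheory GRing.Theory Num.Theory.
Import numFieldNormedType.Exports.

Local Open Scope classical_set_scope.
Local Open Scope ring_scope.

(* Vectors of R^p are column vectors 'cV[R]_p; the l_oo norm is the library's
   mx_norm. Every sup / inf of reals below stands for a max / min (or for a
   sup / inf of a nonempty bounded set). *)

Section Vectors.
Context {R : realType}.

Definition dotv {p} (a x : 'cV[R]_p) : R := (a^T *m x) 0 0.

Definition basisv {p} (i : 'I_p) : 'cV[R]_p := delta_mx i 0.

Definition lev {p} (u v : 'cV[R]_p) : Prop := forall i, u i 0 <= v i 0.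

Definition norm1 {p} (x : 'cV[R]_p) : R := \sum_i `|x i 0|.

Definition norm2 {p} (x : 'cV[R]_p) : R := Num.sqrt (\sum_i (x i 0) ^+ 2).

Definition norm0 {p} (x : 'cV[R]_p) : nat := #|[pred i | x i 0 != 0]|.

Definition is_norm {p} (phi : 'cV[R]_p -> R) : Prop :=
  [/\ forall x y, phi (x + y) <= phi x + phi y,
      forall (t : R) x, phi (t *: x) = `|t| * phi x
    & forall x, phi x = 0 -> x = 0].

Definition unit_ball {p} (phi : 'cV[R]_p -> R) : set 'cV[R]_p :=
  [set x | phi x <= 1].

Definition dual_norm {p} (phi : 'cV[R]_p -> R) (u : 'cV[R]_p) : R :=
  sup [set dotv u x | x in unit_ball phi].

Definition best_approx1 {p} (k : nat) (x : 'cV[R]_p) : R :=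
  inf [set norm1 (x - u) | u in [set u | (norm0 u <= k)%N]].

Definition norm_oo_to_1 {p r} (Q : 'M[R]_(p, r)) : R :=
  sup [set norm1 (Q *m x) | x in [set x : 'cV[R]_r | mx_norm x <= 1]].

Definition hausdorff_dist {p} (X Y : set 'cV[R]_p) : R :=
  Num.max (sup [set inf [set norm2 (u - z) | z in Y] | u in X])
          (sup [set inf [set norm2 (u - z) | u in X] | z in Y]).

End Vectors.

Section Problem.
Context {R : realType} {m n q : nat}.
Variables (A : 'M[R]_(m, n)) (M : 'M[R]_(m, q)) (y : 'cV[R]_m) (mu : R).
Variable phi : 'cV[R]_q -> R.

Definition weak_RSP (k : nat) : Prop :=
  forall S1 S2 : {set 'I_n}, [disjoint S1 & S2]%B -> (#|S1| + #|S2| <= k)%N ->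
  exists zeta : 'cV[R]_n,
    [/\ exists g : 'cV[R]_m, zeta = A^T *m g,
        forall i, i \in S1 -> zeta i 0 = 1,
        forall i, i \in S2 -> zeta i 0 = -1
      & forall i, i \notin S1 :|: S2 -> `|zeta i 0| <= 1].

Definition objective (x : 'cV[R]_n) : R := phi (M^T *m (A *m x - y)).

Definition feasible : set 'cV[R]_n := [set x | norm1 x <= mu].

Definition optimal_solution (x : 'cV[R]_n) : Prop :=
  feasible x /\ forall z, feasible z -> objective x <= objective z.

Definition optimal_value : R := inf [set objective x | x in feasible].

Definition Lambda_star : set 'cV[R]_n :=
  [set x | feasible x /\ objective x <= optimal_value].

Definition Lambda_relaxed (Y : set 'cV[R]_q) : set 'cV[R]_n :=
  [set x | feasible x /\
     forall a, Y a -> dotv a (M^T *m (A *m x - y)) <= optimal_value].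

Definition cols_sub (G : {set 'I_q}) (hG : #|G| = m) : 'M[R]_m :=
  castmx (erefl m, hG) (colsub (fun j : 'I_#|G| => enum_val j) M).

Definition constant_c : R :=
  sup [set r | exists (G : {set 'I_q}) (hG : #|G| = m),
    cols_sub hG \in unitmx /\
    r = norm_oo_to_1 (invmx (cols_sub hG) *m invmx (A *m A^T) *m A)].

End Problem.

Section Polytopes.
Context {R : realType} {q : nat}.

Definition conv_hull (V : seq 'cV[R]_q) : set 'cV[R]_q :=
  [set x | exists w : 'I_(size V) -> R,
    [/\ forall i, 0 <= w i, \sum_i w i = 1 & x = \sum_i w i *: V`_i]].

Definition polytope (K : set 'cV[R]_q) : Prop :=
  exists V : seq 'cV[R]_q, K = conv_hull V.

Definition symmetric_set (K : set 'cV[R]_q) : Prop := forall x, K x -> K (- x).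

Definition vertex (K : set 'cV[R]_q) (v : 'cV[R]_q) : Prop :=
  K v /\ forall x z (t : R), K x -> K z -> 0 < t < 1 ->
         v = t *: x + (1 - t) *: z -> x = z.

Definition at_most_vertices (K : set 'cV[R]_q) (b : R) : Prop :=
  exists V : seq 'cV[R]_q,
    (forall v, vertex K v -> v \in V) /\ (size V)%:R <= b.

Definition dilate (t : R) (K : set 'cV[R]_q) : set 'cV[R]_q :=
  [set t *: x | x in K].

Definition barvinok_polytope (phi : 'cV[R]_q -> R) (chi eps : R)
    (K : set 'cV[R]_q) : Prop :=
  [/\ polytope K, symmetric_set K,
      at_most_vertices K ((chi / Num.sqrt eps * ln (1 / eps)) ^+ q),
      K `<=` unit_ball phi
    & unit_ball phi `<=` dilate (1 + eps) K].

Definition affinely_independent {r} (x : 'I_r -> 'cV[R]_q) : Prop :=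
  forall w : 'I_r -> R, \sum_i w i = 0 -> \sum_i w i *: x i = 0 ->
  forall i, w i = 0.

(* For a full-dimensional K in R^q: a facet is a (q-1)-dimensional face, i.e.
   one containing q affinely independent points. *)
Definition outer_facet_normal (K : set 'cV[R]_q) (a : 'cV[R]_q) : Prop :=
  a <> 0 /\ exists b : R,
    (forall x, K x -> dotv a x <= b) /\
    exists x : 'I_q -> 'cV[R]_q,
      affinely_independent x /\ forall i, K (x i) /\ dotv a (x i) = b.

Variables (phi : 'cV[R]_q -> R) (P : R -> set 'cV[R]_q) (eps : nat -> R).

(* With dual_norm phi a = 1 the hyperplane {x | dotv a x = 1} is the parallel
   translate of the facet hyperplane that touches the unit ball of phi. *)
Definition normals_hat (e : R) : set 'cV[R]_q :=
  [set a | outer_facet_normal (dilate (1 + e) (P e)) a /\ dual_norm phi a = 1].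

Definition P_hat (e : R) : set 'cV[R]_q :=
  [set z | forall a, normals_hat e a -> dotv a z <= 1].

Definition P_bar (e : R) : set 'cV[R]_q :=
  P_hat e `&`
  [set z | forall i, dotv (basisv i) z <= 1 /\ dotv (- basisv i) z <= 1].

Definition Q_poly (j : nat) : set 'cV[R]_q :=
  [set z | forall k, (1 <= k <= j)%N -> P_bar (eps k) z].

Definition normals_Q (j : nat) : set 'cV[R]_q :=
  [set a | (exists2 k, (1 <= k <= j)%N & normals_hat (eps k) a) \/
           exists i, a = basisv i \/ a = - basisv i].

Lemma Q_polyE j : (1 <= j)%N ->
  Q_poly j = [set z | forall a, normals_Q j a -> dotv a z <= 1].
Proof.
move=> j1; apply/seteqP; split=> z /= Hz.
- move=> a [[k kj Ha]|[i Hi]].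
    by case: (Hz k kj) => + _; exact.
  have [|_ /(_ i) [H1 H2]] := Hz j; first by rewrite j1 leqnn.
  by case: Hi => ->.
- move=> k kj; split=> [a Ha|i]; first by apply: Hz; left; exists k.
  by split; apply: Hz; right; exists i; [left|right].
Qed.

(* The columns of Gam list each element of Y exactly once, in any order. *)
Definition matrix_of_normals {nhat} (Y : set 'cV[R]_q) (Gam : 'M[R]_(q, nhat))
    : Prop :=
  injective (fun i => col i Gam) /\ Y = range (fun i => col i Gam).

End Polytopes.

Section Robinson.
Context {R : realType}.

(* A norm index alpha is given by the norms ||.||_alpha on all the R^p. *)
Definition norm_family := forall p : nat, 'cV[R]_p -> R.

Definition family_oo : norm_family := fun p => @mx_norm R p 1.
Definition family_2 : norm_family := fun p => @norm2 R p.

Definition solves {p1 p2 r} (M1 : 'M[R]_(p1, r)) (M2 : 'M[R]_(p2, r))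
    (d : 'cV[R]_p1 * 'cV[R]_p2) : set 'cV[R]_r :=
  [set u | lev (M1 *m u) d.1 /\ M2 *m u = d.2].

Definition robinson_mu (a1 a2 : norm_family) {p1 p2 r}
    (M1 : 'M[R]_(p1, r)) (M2 : 'M[R]_(p2, r)) : R :=
  sup [set inf [set a1 r u | u in solves M1 M2 d] |
       d in [set d | (exists u, solves M1 M2 d u) /\
                     a2 (p1 + p2)%N (col_mx d.1 d.2) <= 1]].

Definition robinson_sigma (a1 a2 : norm_family) {m1 m2 l}
    (N1 : 'M[R]_(m1, l)) (N2 : 'M[R]_(m2, l)) : R :=
  sup [set robinson_mu a1 a2
         (block_mx (rowsub (fun i : 'I_#|S| => enum_val i) 1%:M)
                   (0 : 'M[R]_(#|S|, m2))
                   (- 1%:M) (0 : 'M[R]_(m1, m2)))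
         (col_mx N1 N2)^T | S in [set: {set 'I_m1}]].

End Robinson.

Section HatMatrices.
Context {R : realType} {m n q nhat : nat}.

Definition row7 {p} (B1 : 'M[R]_(p, n)) (B2 : 'M[R]_(p, n)) (B3 : 'M[R]_(p, 1))
    (B4 : 'M[R]_(p, n)) (B5 : 'M[R]_(p, n)) (B6 : 'M[R]_(p, 1))
    (B7 : 'M[R]_(p, nhat)) : 'M[R]_(p, n + (n + (1 + (n + (n + (1 + nhat)))))) :=
  row_mx B1 (row_mx B2 (row_mx B3 (row_mx B4 (row_mx B5 (row_mx B6 B7))))).

Variables (A : 'M[R]_(m, n)) (M : 'M[R]_(m, q)) (y : 'cV[R]_m) (mu : R).
Variable Gam : 'M[R]_(q, nhat).

Let en : 'cV[R]_n := const_mx 1.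
Let ehat : 'cV[R]_nhat := const_mx 1.
Let I : 'M[R]_n := 1%:M.
Let I1 : 'M[R]_1 := 1%:M.
Let Ihat : 'M[R]_nhat := 1%:M.
Let MG : 'M[R]_(m, nhat) := M *m Gam.

Definition Mhat1 :=
  col_mx (row7 I            (- I)  0        0     0     0      0) (
  col_mx (row7 (- I)        (- I)  0        0     0     0      0) (
  col_mx (row7 0            en^T   0        0     0     0      0) (
  col_mx (row7 (MG^T *m A)  0      (- ehat) 0     0     0      0) (
  col_mx (row7 0            0      0        I     I     (- en) 0) (
  col_mx (row7 0            0      0        0     0     0      ehat^T) (
  col_mx (row7 0            (- I)  0        0     0     0      0) (
  col_mx (row7 0            0      (- I1)   0     0     0      0) (
  col_mx (row7 0            0      0        (- I) 0     0      0) (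
  col_mx (row7 0            0      0        0     (- I) 0      0) (
  col_mx (row7 0            0      0        0     0     (- I1) 0)
         (row7 0            0      0        0     0     0      (- Ihat)))))))))))).

Definition Mhat2 :=
  col_mx (row7 0 0 0  I (- I) 0         (A^T *m MG))
         (row7 0 0 I1 0 0     (mu%:M)   (y^T *m MG)).

End HatMatrices.

(* Main.v *)
(* Replacing phi by the gauge of Q gives a linear program; the hat matrices
   encode primal feasibility, dual feasibility and equality of the two values,
   so by strong duality the hat system is solvable, and by weak duality the
   x-part of any of its solutions lies in Lambda_relaxed, hence within delta of
   an optimal solution.  Robinson's constant bounds the distance from a test
   vector to the solution set by the residual: the projection error is a
   combination of active normals, whose multipliers can be chosen bounded by
   that constant.  The test vector is x, |x|, phi(M^T(Ax-y)) together with dual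
   variables tau * zeta^+, tau * zeta^-, tau, w4, where zeta in range(A^T) is the
   sign certificate given by the weak RSP, tau = 1/c, and w4 >= 0 solves
   M Gamma w4 = - tau (A A^T)^-1 A zeta with total mass at most 1.
   All facts on linear inequalities come from one Fourier-Motzkin elimination
   that also records a bound on the solution. *)
Require Import Defs.
From HB Require Import structures.
From mathcomp Require Import all_boot all_order all_algebra.
From mathcomp Require Import all_classical all_reals all_analysis.
From mathcomp Require Import ring lra.

Set Implicit Arguments.
Unset Strict Implicit.
Unset Printing Implicit Defensive.

Import Order.TTheory GRing.Theory Num.Theory.
Import numFieldNormedType.Exports.

Local Open Scope classical_set_scope.
Local Open Scope ring_scope.

(** * Linear inequalities *)

(** Take the largest lower bound if there is one, otherwise the smallest upper bound, otherwise 0.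
    The last clause leaves only finitely many possible values for [t], which is how the eliminated
    variable gets bounded later. *)
Lemma separating_point (R : realFieldType) (I : finType) (lo up : pred I) (s : I -> R) :
  (forall i j, lo i -> up j -> s i <= s j) ->
  exists t : R, [/\ forall i, lo i -> s i <= t, forall j, up j -> t <= s j
    & t = 0 \/ exists i, t = s i].
Proof.
move=> los.
have [[i0 li0]|nolo] := pselect (exists i, lo i).
  have [i li imax] := @Order.TotalTheory.arg_maxP _ _ _ i0 lo s li0.
  by exists (s i); split=> [k /imax|j /(los _ _ li)|] //; right; exists i.
have [[j0 uj0]|noup] := pselect (exists j, up j).
  have [j uj jmin] := @Order.TotalTheory.arg_minP _ _ _ j0 up s uj0.
  by exists (s j); split=> [k lk|k /jmin|] //; [case: nolo; exists k|right; exists j].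
by exists 0; split=> [k lk|k uk|]; [case: nolo; exists k|case: noup; exists k|left].
Qed.

Lemma sum_delta (R : pzRingType) (I : finType) (i0 : I) (F : I -> R) :
  \sum_i (i == i0)%:R * F i = F i0.
Proof.
rewrite (bigD1 i0) //= eqxx mul1r big1 ?addr0 // => i /negbTE ->.
by rewrite mul0r.
Qed.

Lemma sum_mulA (R : pzRingType) (I J : finType) (x : J -> R) (K : J -> I -> R)
    (F : I -> R) :
  \sum_j x j * (\sum_i K j i * F i) = \sum_i (\sum_j x j * K j i) * F i.
Proof.
under eq_bigr do rewrite mulr_sumr.
rewrite exchange_big /=; apply: eq_bigr => i _.
by rewrite mulr_suml; apply: eq_bigr => j _; rewrite mulrA.
Qed.

(** Induction on the number of variables, eliminating the one of index [r]. Each row of [L] is a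
    nonnegative combination in which all variables cancel. The constant [C] depends on the
    coefficients only; this uniformity in [b] is what makes Robinson's constant finite. Indexing
    variables by [nat] keeps the type of [a] fixed through the induction. *)
Lemma fourier_motzkin (R : realFieldType) (r : nat) :
  forall (I : finType) (a : I -> nat -> R),
  exists (J : finType) (L : J -> I -> R) (C : R),
  [/\ 0 <= C, forall j i, 0 <= L j i,
      forall j k, (k < r)%N -> \sum_i L j i * a i k = 0
    & forall (b : I -> R) (B : R), (forall i, `|b i| <= B) ->
      (forall j, 0 <= \sum_i L j i * b i) ->
      exists u : nat -> R,
        (forall i, \sum_(k < r) a i k * u k <= b i) /\
        (forall k, (k < r)%N -> `|u k| <= C * B)].
Proof.
elim: r => [|r IHr] I a.
  exists I, (fun j i => (i == j)%:R), 0; split=> //.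
  move=> b B bB b0; exists (fun=> 0); split=> // i.
  by rewrite big_ord0; have := b0 i; rewrite sum_delta.
(* Rows of the eliminated system: two rows whose last coefficients have opposite signs are scaled to
   1 and -1 and added, a row with last coefficient 0 is kept, and every other index gives the zero
   row. *)
pose K (j : I * I + I) (i : I) : R :=
  match j with
  | inl p => if (0 < a p.1 r) && (a p.2 r < 0)
             then (i == p.1)%:R / a p.1 r + (i == p.2)%:R / - a p.2 r else 0
  | inr i' => if a i' r == 0 then (i == i')%:R else 0
  end.
have K0 j i : 0 <= K j i.
  case: j => [[i1 i2]|i'] /=; case: ifP => //.
  move=> /andP[h1 h2]; apply: addr_ge0; apply: divr_ge0; rewrite ?ler0n ?ltW //.
  by rewrite oppr_gt0.
have Kp i1 i2 F : 0 < a i1 r -> a i2 r < 0 ->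
    \sum_i K (inl (i1, i2)) i * F i = F i1 / a i1 r - F i2 / a i2 r.
  move=> h1 h2; rewrite /K /= h1 h2 /=.
  under eq_bigr do rewrite mulrDl mulrAC (mulrAC _ _ (F _)).
  by rewrite big_split /= -!mulr_suml !sum_delta invrN mulrN.
have Kz i' F : a i' r = 0 -> \sum_i K (inr i') i * F i = F i'.
  by move=> h; rewrite /K /= h eqxx sum_delta.
have Kr j : \sum_i K j i * a i r = 0.
  case: j => [[i1 i2]|i'].
    case E: ((0 < a i1 r) && (a i2 r < 0)); last first.
      by rewrite /K /= E big1 // => i _; rewrite mul0r.
    move/andP: E => [h1 h2]; rewrite Kp // !divff ?subrr //.
      by rewrite lt_eqF.
    by rewrite gt_eqF.
  case: (eqVneq (a i' r) 0) => [h|/negbTE h]; first by rewrite Kz.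
  by rewrite /K h big1 // => i _; rewrite mul0r.
have [J [L [C [C0 L0 La Lb]]]] := IHr _ (fun j k => \sum_i K j i * a i k).
(* [C1] bounds the growth of the right-hand side under [K]; [C2] bounds, relative to [B], every
   candidate value of the last variable. Rows with last coefficient 0 contribute 0, since division
   by 0 returns 0. *)
pose C1 := \sum_j \sum_i K j i.
have C10 : 0 <= C1 by apply: sumr_ge0 => j _; apply: sumr_ge0.
pose C2 := \sum_i (1 + \sum_(k < r) `|a i k| * (C * C1)) / `|a i r|.
have T0 i : 0 <= (1 + \sum_(k < r) `|a i k| * (C * C1)) / `|a i r|.
  rewrite divr_ge0 ?addr_ge0 //; apply: sumr_ge0 => k _.
  by rewrite !mulr_ge0.
have C20 : 0 <= C2 by apply: sumr_ge0.
exists J, (fun j i => \sum_j' L j j' * K j' i), (C * C1 + C2); split.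
- by rewrite addr_ge0 ?mulr_ge0.
- by move=> j i; apply: sumr_ge0 => j' _; rewrite mulr_ge0.
- move=> j k; rewrite -sum_mulA ltnS leq_eqVlt => /orP[/eqP -> | kr].
    by rewrite big1 // => j' _; rewrite Kr mulr0.
  exact: La.
move=> b B bB Lb0.
have B0 (i : I) : 0 <= B by apply: le_trans (bB i).
have [u [uK uB]] : exists u : nat -> R,
    (forall j, \sum_(k < r) (\sum_i K j i * a i k) * u k <= \sum_i K j i * b i) /\
    (forall k, (k < r)%N -> `|u k| <= C * (C1 * B)).
  apply: Lb => [j|j]; last by rewrite sum_mulA.
  apply: le_trans (ler_norm_sum _ _ _) _.
  apply: (@le_trans _ _ ((\sum_i K j i) * B)).
    rewrite mulr_suml; apply: ler_sum => i _.
    by rewrite normrM ger0_norm // ler_wpM2l.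
  rewrite /C1 (bigD1 j) //= mulrDl lerDl mulr_suml.
  apply: sumr_ge0 => j' _; rewrite mulr_suml; apply: sumr_ge0 => i _.
  by rewrite mulr_ge0 // B0.
pose S i := \sum_(k < r) a i k * u k.
have uS j : \sum_i K j i * S i <= \sum_i K j i * b i.
  apply: le_trans (uK j); rewrite le_eqVlt; apply/orP; left; apply/eqP.
  under [LHS]eq_bigr do rewrite mulr_sumr.
  rewrite exchange_big /=; apply: eq_bigr => k _.
  by rewrite mulr_suml; apply: eq_bigr => i _; rewrite mulrA.
(* The combined row of a pair says exactly that the lower bound from [i2] does not exceed the upper
   bound from [i1]. *)
have sep i2 i1 : a i2 r < 0 -> 0 < a i1 r ->
    (b i2 - S i2) / a i2 r <= (b i1 - S i1) / a i1 r.
  move=> h2 h1; have := uS (inl (i1, i2)); rewrite !Kp // !mulrBl.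
  rewrite -subr_ge0 => h; rewrite -subr_ge0; apply: le_trans h _.
  rewrite le_eqVlt; apply/orP; left; apply/eqP; ring.
have [t [tlo tup tv]] := separating_point sep.
exists (fun k => if (k < r)%N then u k else t); split=> [i|k].
  rewrite big_ord_recr /= ltnn.
  rewrite (eq_bigr (fun k : 'I_r => a i k * u k)); last by move=> k _; rewrite ltn_ord.
  rewrite -/(S i) addrC -lerBrDr.
  case: (ltgtP (a i r) 0) => h.
  - by have := tlo _ h; rewrite ler_ndivrMr // mulrC.
  - by have := tup _ h; rewrite ler_pdivlMr // mulrC.
  - by have := uS (inr i); rewrite h mul0r !Kz // subr_ge0.
rewrite ltnS mulrDl => _; case: ifP => [kr|_].
  apply: le_trans (uB _ kr) _; rewrite mulrA lerDl.
  (* [B] can be negative only when [I] is empty, and then [C1] and [C2] are empty sums. *)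
  case: (pselect (exists i : I, True)) => [[i _]|noI].
    by rewrite mulr_ge0 // (B0 i).
  by rewrite /C2 big1 ?mul0r // => i; case: noI; exists i.
case: (pselect (exists i : I, True)) => [[i _]|noI]; last first.
  case: tv => [->|[i _]]; last by case: noI; exists i.
  rewrite /C1 /C2 big1 ?mulr0 ?mul0r ?add0r; last first.
    move=> [[i ?]|i] _; by case: noI; exists i.
  by rewrite big1 ?mul0r ?normr0 // => i; case: noI; exists i.
have {i}BB : 0 <= B := B0 i.
case: tv => [->|[i ->]]; first by rewrite normr0 addr_ge0 ?mulr_ge0.
rewrite -[leLHS]add0r; apply: lerD; first by rewrite !mulr_ge0.
rewrite normrM normfV.
have h : `|b i - S i| <= (1 + \sum_(k < r) `|a i k| * (C * C1)) * B.
  apply: le_trans (ler_normB _ _) _; rewrite mulrDl mul1r; apply: lerD => //.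
  apply: le_trans (ler_norm_sum _ _ _) _; rewrite mulr_suml; apply: ler_sum => l _.
  by rewrite normrM -mulrA ler_wpM2l // -mulrA uB.
apply: le_trans (ler_wpM2r _ h) _; first by rewrite invr_ge0.
rewrite mulrAC ler_wpM2r // /C2 (bigD1 i) //= lerDl.
by apply: sumr_ge0.
Qed.

(** * Inner product and entrywise order *)

Section DotProduct.
Context {R : realType} {p : nat}.
Implicit Types u v w : 'cV[R]_p.

Lemma dotvE u v : dotv u v = \sum_i u i 0 * v i 0.
Proof. by rewrite /dotv mxE; apply: eq_bigr => i _; rewrite mxE. Qed.

Lemma dotvC u v : dotv u v = dotv v u.
Proof. by rewrite !dotvE; apply: eq_bigr => i _; rewrite mulrC. Qed.

Lemma dotvDr u v w : dotv u (v + w) = dotv u v + dotv u w.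
Proof. by rewrite /dotv mulmxDr mxE. Qed.

Lemma dotvNr u v : dotv u (- v) = - dotv u v.
Proof. by rewrite /dotv mulmxN mxE. Qed.

Lemma dotvBr u v w : dotv u (v - w) = dotv u v - dotv u w.
Proof. by rewrite dotvDr dotvNr. Qed.

Lemma dotvZr (a : R) u v : dotv u (a *: v) = a * dotv u v.
Proof. by rewrite /dotv -scalemxAr mxE. Qed.

Lemma dotv0r u : dotv u 0 = 0.
Proof. by rewrite /dotv mulmx0 mxE. Qed.

Lemma dotvZl (a : R) u v : dotv (a *: u) v = a * dotv u v.
Proof. by rewrite dotvC dotvZr dotvC. Qed.

Lemma dotvNl u v : dotv (- u) v = - dotv u v.
Proof. by rewrite dotvC dotvNr dotvC. Qed.

Lemma dotv_mulmx {r} (D : 'M[R]_(p, r)) u (z : 'cV[R]_r) :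
  dotv u (D *m z) = dotv (D^T *m u) z.
Proof. by rewrite /dotv trmx_mul trmxK mulmxA. Qed.

Lemma ler_dotv u v w : lev 0 u -> lev v w -> dotv u v <= dotv u w.
Proof.
move=> u0 vw; rewrite !dotvE; apply: ler_sum => i _.
by apply: ler_wpM2l => //; have := u0 i; rewrite mxE.
Qed.

End DotProduct.

Lemma dotv_col_mx {R : realType} {p1 p2} (a c : 'cV[R]_p1) (b d : 'cV[R]_p2) :
  dotv (col_mx a b) (col_mx c d) = dotv a c + dotv b d.
Proof. by rewrite /dotv tr_col_mx mul_row_col mxE. Qed.

Lemma lev_col_mx {R : realType} {p1 p2} (a c : 'cV[R]_p1) (b d : 'cV[R]_p2) :
  lev (col_mx a b) (col_mx c d) <-> lev a c /\ lev b d.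
Proof.
split=> [h|[h1 h2] i]; last first.
  by case: (split_ordP i) => j ->; rewrite ?col_mxEu ?col_mxEd.
split=> i; first by have := h (lshift _ i); rewrite !col_mxEu.
by have := h (rshift _ i); rewrite !col_mxEd.
Qed.

Lemma lev0_col_mx {R : realType} {p1 p2} (a : 'cV[R]_p1) (b : 'cV[R]_p2) :
  lev 0 (col_mx a b) <-> lev 0 a /\ lev 0 b.
Proof. by rewrite -[X in lev X _]col_mx0; exact: lev_col_mx. Qed.

Lemma trmxN {V : zmodType} {p r} (X : 'M[V]_(p, r)) : (- X)^T = - X^T.
Proof. by apply/matrixP => i j; rewrite !mxE. Qed.

(** * Matrix form of elimination: bounded solutions, Farkas, strong duality *)

Section LinearInequalities.
Context {R : realType}.

Lemma fourier_motzkin_mx {p r} (D : 'M[R]_(p, r)) :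
  exists (J : finType) (L : J -> 'cV[R]_p) (C : R),
  [/\ 0 <= C, forall j, lev 0 (L j), forall j, D^T *m L j = 0
    & forall (b : 'cV[R]_p) (B : R), (forall i, `|b i 0| <= B) ->
      (forall j, 0 <= dotv (L j) b) ->
      exists u : 'cV[R]_r, lev (D *m u) b /\ forall i, `|u i 0| <= C * B].
Proof.
pose a (i : 'I_p) (k : nat) : R := oapp (D i) 0 (insub k).
have aE i (k : 'I_r) : a i k = D i k by rewrite /a valK.
have [J [L [C [C0 L0 La Lb]]]] := @fourier_motzkin R r _ a.
exists J, (fun j => \col_i L j i), C; split=> //.
- by move=> j i; rewrite !mxE.
- move=> j; apply/colP => k; rewrite !mxE -[RHS](La j k (ltn_ord k)).
  by apply: eq_bigr => i _; rewrite !mxE aE mulrC.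
move=> b B bB b0; have [j|u [uD uB]] := Lb (fun i => b i 0) B bB.
  by have := b0 j; rewrite dotvE; under eq_bigr do rewrite mxE.
exists (\col_k u k); split=> i; last by rewrite mxE uB.
apply: le_trans (uD i); rewrite mxE le_eqVlt; apply/orP; left; apply/eqP.
by apply: eq_bigr => k _; rewrite mxE aE.
Qed.

Lemma lev_certificate {p r} (D : 'M[R]_(p, r)) (l b : 'cV[R]_p) (u : 'cV[R]_r) :
  lev 0 l -> D^T *m l = 0 -> lev (D *m u) b -> 0 <= dotv l b.
Proof.
move=> l0 Dl ub; apply: le_trans (ler_dotv l0 ub).
by rewrite dotv_mulmx Dl dotvC dotv0r.
Qed.

Lemma entry_le_sum {p} (b : 'cV[R]_p) i : `|b i 0| <= \sum_i `|b i 0|.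
Proof. by rewrite (bigD1 i) //= lerDl sumr_ge0. Qed.

(** A solvable system satisfies all eliminated inequalities by [lev_certificate], so elimination
    returns a solution of controlled size, with [C] chosen before [b]. *)
Lemma bounded_solution {p r} (D : 'M[R]_(p, r)) :
  exists C : R, 0 <= C /\
    forall (b : 'cV[R]_p) (B : R), (forall i, `|b i 0| <= B) ->
      (exists u, lev (D *m u) b) ->
      exists u : 'cV[R]_r, lev (D *m u) b /\ forall i, `|u i 0| <= C * B.
Proof.
have [J [L [C [C0 L0 DL Lb]]]] := fourier_motzkin_mx D.
exists C; split=> // b B bB [u ub]; apply: Lb bB _ => j.
exact: lev_certificate (L0 j) (DL j) ub.
Qed.

(** The eliminated inequalities decide solvability, and one that fails is itself the certificate. *)
Lemma farkas {p r} (D : 'M[R]_(p, r)) (b : 'cV[R]_p) :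
  (exists u, lev (D *m u) b) \/
  exists l, [/\ lev 0 l, D^T *m l = 0 & dotv l b < 0].
Proof.
have [J [L [C [C0 L0 DL Lb]]]] := fourier_motzkin_mx D.
have [[j lj]|nl] := pselect (exists j, dotv (L j) b < 0).
  by right; exists (L j).
left; have [|u [ub _]] := Lb b _ (entry_le_sum b); last by exists u.
by move=> j; rewrite leNgt; apply/negP => lj; apply: nl; exists j.
Qed.

(** Eliminate [z] from [G z <= h], [c z <= t]. What remains are inequalities in [t] alone, each of
    the form [al h + tau t >= 0]; the binding one gives the optimal value, and its multipliers [al],
    divided by [tau], give the dual solution. *)
Lemma lp_strong_duality {p r} (G : 'M[R]_(p, r)) (h : 'cV[R]_p) (c : 'cV[R]_r)
    (z0 : 'cV[R]_r) (beta : R) :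
  lev (G *m z0) h -> (forall z, lev (G *m z) h -> beta <= dotv c z) ->
  exists (z : 'cV[R]_r) (l : 'cV[R]_p),
    [/\ lev (G *m z) h, lev 0 l, G^T *m l = - c & dotv c z + dotv h l <= 0].
Proof.
move=> Gz0 zb; have [J [L [C [C0 L0 DL Lb]]]] := fourier_motzkin_mx (col_mx G c^T).
pose al j := usubmx (L j); pose tau j := dsubmx (L j) 0 0.
have LE j : L j = col_mx (al j) (tau j)%:M.
  by rewrite -[LHS]vsubmxK [dsubmx _]mx11_scalar.
have alt j : lev 0 (al j) /\ 0 <= tau j.
  have /lev0_col_mx[h1 h2] : lev 0 (col_mx (al j) (tau j)%:M) by rewrite -LE.
  split; first exact: h1.
  by have := h2 0; rewrite [leLHS]mxE [leRHS]mxE eqxx mulr1n.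
have al0 j := (alt j).1; have tau0 j := (alt j).2.
have Gal j : G^T *m al j = - tau j *: c.
  have := DL j; rewrite LE tr_col_mx mul_row_col trmxK => /eqP.
  by rewrite addr_eq0 => /eqP ->; rewrite scaleNr mul_mx_scalar.
have dL j t : dotv (L j) (col_mx h t%:M) = dotv (al j) h + tau j * t.
  by rewrite LE dotv_col_mx; congr (_ + _); rewrite dotvE big_ord1 !mxE.
have feas t : (forall j, 0 <= dotv (al j) h + tau j * t) ->
    exists z, lev (G *m z) h /\ dotv c z <= t.
  move=> ht; have [j|z []] := Lb (col_mx h t%:M) _ (entry_le_sum _).
    by rewrite dL.
  rewrite mul_col_mx => /lev_col_mx[h1 h2] _; exists z; split=> //.
  by have := h2 0; rewrite /dotv [leRHS]mxE.
have alz0 j : - tau j * dotv c z0 <= dotv (al j) h.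
  by have := ler_dotv (al0 j) Gz0; rewrite dotv_mulmx Gal dotvZl.
(* If no row constrains [t], every value is attainable, in particular [beta - 1], against the lower
   bound [beta]. *)
have [[j1 j1p]|np] := pselect (exists j, 0 < tau j); last first.
  have tau_0 j : tau j = 0.
    apply/eqP; rewrite eq_le tau0 andbT leNgt; apply/negP => lj.
    by apply: np; exists j.
  have [j|z [/zb z1 z2]] := feas (beta - 1).
    by rewrite tau_0 mul0r addr0; have := alz0 j; rewrite tau_0 oppr0 mul0r.
  lra.
(* The row that gives the largest lower bound on [t]. *)
have [j jp jmax] := @Order.TotalTheory.arg_maxP _ _ _ j1 (fun j => 0 < tau j)
  (fun j => - dotv (al j) h / tau j) j1p.
have [j'|z [z1 z2]] := feas (- dotv (al j) h / tau j).
  have := tau0 j'; rewrite le_eqVlt => /orP[/eqP t0|t0].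
    by rewrite -t0 mul0r addr0; have := alz0 j'; rewrite -t0 oppr0 mul0r.
  by rewrite -lerBlDl sub0r mulrC -ler_pdivrMr //; apply: jmax.
exists z, ((tau j)^-1 *: al j); split=> //.
- move=> i; rewrite [leLHS]mxE [leRHS]mxE; apply: mulr_ge0.
    by rewrite invr_ge0 ltW.
  by have := al0 j i; rewrite mxE.
- by rewrite -scalemxAr Gal scalerA mulrN mulVf ?scaleN1r // gt_eqF.
rewrite dotvZr (dotvC h) -lerBrDr sub0r; apply: le_trans z2 _.
by rewrite mulrC mulrN.
Qed.

End LinearInequalities.

(** * Norms and compactness *)

Section Norms.
Context {R : realType} {p : nat}.
Implicit Types u v w : 'cV[R]_p.

Lemma norm1_ge0 u : 0 <= norm1 u.
Proof. exact: sumr_ge0. Qed.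

Lemma norm1D u v : norm1 (u + v) <= norm1 u + norm1 v.
Proof.
rewrite /norm1 -big_split /=; apply: ler_sum => i _.
by rewrite mxE ler_normD.
Qed.

Lemma norm1N u : norm1 (- u) = norm1 u.
Proof. by apply: eq_bigr => i _; rewrite mxE normrN. Qed.

Lemma norm1Z (a : R) u : norm1 (a *: u) = `|a| * norm1 u.
Proof. by rewrite /norm1 mulr_sumr; apply: eq_bigr => i _; rewrite mxE normrM. Qed.

Lemma entry_le_norm1 u i : `|u i 0| <= norm1 u.
Proof. exact: entry_le_sum. Qed.

Lemma norm2_ge0 u : 0 <= norm2 u.
Proof. exact: sqrtr_ge0. Qed.

Lemma norm2_sqr u : norm2 u ^+ 2 = dotv u u.
Proof.
rewrite /norm2 sqr_sqrtr ?dotvE; last by apply: sumr_ge0 => i _; rewrite sqr_ge0.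
by apply: eq_bigr => i _; rewrite expr2.
Qed.

Lemma norm2N u : norm2 (- u) = norm2 u.
Proof. by congr Num.sqrt; apply: eq_bigr => i _; rewrite mxE sqrrN. Qed.

Lemma norm2Z (a : R) u : 0 <= a -> norm2 (a *: u) = a * norm2 u.
Proof.
move=> a0; apply/eqP; rewrite -(@eqrXn2 _ 2) ?mulr_ge0 ?norm2_ge0 //.
by rewrite exprMn !norm2_sqr dotvZl dotvZr mulrA expr2.
Qed.

Lemma entry_le_norm2 u i : `|u i 0| <= norm2 u.
Proof.
rewrite -(@ler_pXn2r _ 2) ?nnegrE ?norm2_ge0 // norm2_sqr dotvE.
rewrite real_normK ?num_real // (bigD1 i) //= expr2 lerDl.
by apply: sumr_ge0 => j _; rewrite -expr2 sqr_ge0.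
Qed.

Lemma norm2_eq0 u : norm2 u = 0 -> u = 0.
Proof.
move=> u0; apply/colP => i; rewrite mxE; apply/eqP; rewrite -normr_le0 -u0.
exact: entry_le_norm2.
Qed.

Lemma cauchy_schwarz u v : dotv u v <= norm2 u * norm2 v.
Proof.
have [u0|u0] := eqVneq (norm2 u) 0.
  by rewrite u0 (norm2_eq0 u0) dotvC dotv0r mul0r.
have [v0|v0] := eqVneq (norm2 v) 0.
  by rewrite v0 (norm2_eq0 v0) dotv0r mulr0.
have up : 0 < norm2 u by rewrite lt_def u0 norm2_ge0.
have vp : 0 < norm2 v by rewrite lt_def v0 norm2_ge0.
have : 0 <= norm2 (norm2 v *: u - norm2 u *: v) ^+ 2 by rewrite sqr_ge0.
rewrite norm2_sqr dotvBr (dotvC _ (_ *: u)) (dotvC _ (_ *: v)) !dotvBr.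
rewrite !dotvZl !dotvZr -!norm2_sqr (dotvC v u).
move: (norm2 u) (norm2 v) (dotv u v) up vp => a b c a0 b0 h.
have : 0 <= a * b * (a * b - c) by nra.
by rewrite pmulr_rge0 ?mulr_gt0 // subr_ge0.
Qed.

Lemma norm2D u v : norm2 (u + v) <= norm2 u + norm2 v.
Proof.
rewrite -(@ler_pXn2r _ 2) ?nnegrE ?norm2_ge0 ?addr_ge0 ?norm2_ge0 //.
rewrite norm2_sqr dotvDr !(dotvC (u + v)) !dotvDr -!norm2_sqr (dotvC v u).
by have := cauchy_schwarz u v; lra.
Qed.

Lemma norm2_le_norm1 u : norm2 u <= norm1 u.
Proof.
rewrite -(@ler_pXn2r _ 2) ?nnegrE ?norm2_ge0 ?norm1_ge0 // norm2_sqr dotvE.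
rewrite expr2 {1}/norm1 mulr_suml; apply: ler_sum => i _.
by rewrite (le_trans (ler_norm _)) // normrM ler_wpM2l // entry_le_norm1.
Qed.

Lemma norm2_distC u v : norm2 (u - v) = norm2 (v - u).
Proof. by rewrite -norm2N opprB. Qed.

Lemma norm1_distC u v : norm1 (u - v) = norm1 (v - u).
Proof. by rewrite -norm1N opprB. Qed.

Lemma dotv_abs_le u v (B : R) :
  (forall i, `|u i 0| <= B) -> `|dotv u v| <= B * norm1 v.
Proof.
move=> uB; rewrite dotvE; apply: le_trans (ler_norm_sum _ _ _) _.
by rewrite mulr_sumr; apply: ler_sum => i _; rewrite normrM ler_wpM2r.
Qed.

End Norms.

Lemma entry_le_mx_norm {R : realType} {p} (u : 'cV[R]_p) i : `|u i 0| <= mx_norm u.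
Proof.
by rewrite mx_normrE; apply: (le_bigmax _ (fun ij => `|u ij.1 ij.2|) (i, 0)).
Qed.

Lemma mx_norm_le {R : realType} {p} (u : 'cV[R]_p) (B : R) :
  0 <= B -> (forall i, `|u i 0| <= B) -> mx_norm u <= B.
Proof.
by move=> B0 uB; rewrite mx_normrE; apply/bigmax_leP; split=> // -[i j] _; rewrite ord1 uB.
Qed.

Lemma mx_norm_ge0 {R : realType} {p} (u : 'cV[R]_p) : 0 <= mx_norm u.
Proof. exact: (normr_ge0 u). Qed.

Lemma mulmx_bounded {R : realType} {p r} (Q : 'M[R]_(p, r)) :
  exists2 C : R, 0 <= C & forall x, norm1 (Q *m x) <= C * mx_norm x.
Proof.
exists (\sum_i \sum_j `|Q i j|); first by do 2 (apply: sumr_ge0 => ? _).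
move=> x; rewrite mulr_suml; apply: ler_sum => i _.
rewrite mxE; apply: le_trans (ler_norm_sum _ _ _) _; rewrite mulr_suml.
apply: ler_sum => j _; rewrite normrM ler_wpM2l //.
exact: entry_le_mx_norm.
Qed.

Lemma mx_norm_le_norm1 {R : realType} {p} (u : 'cV[R]_p) : mx_norm u <= norm1 u.
Proof. by apply: mx_norm_le (norm1_ge0 _) _ => i; apply: entry_le_norm1. Qed.

Lemma mulmx_norm1_bounded {R : realType} {p r} (Q : 'M[R]_(p, r)) :
  exists2 C : R, 0 <= C & forall x, norm1 (Q *m x) <= C * norm1 x.
Proof.
have [C C0 QC] := mulmx_bounded Q; exists C => // x.
by apply: le_trans (QC x) _; rewrite ler_wpM2l // mx_norm_le_norm1.
Qed.

Section Compactness.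
Context {R : realType} {p : nat}.

(** A one-sided estimate suffices, since exchanging [u] and [v] gives the other side. The topology
    is that of the sup norm, so [norm1] is first compared with it. *)
Lemma lipschitz1_continuous (f : 'cV[R]_p -> R) (C : R) :
  (forall u v, f u - f v <= C * norm1 (u - v)) -> continuous f.
Proof.
move=> fC x S /nbhs_ballP [e /= e0 eS].
have [C' C'0 C'n] := mulmx_bounded (1%:M : 'M[R]_p).
pose K := `|C| * C' + 1.
have K0 : 0 < K by rewrite ltr_wpDl // mulr_ge0.
have fle u v : f u - f v <= K * mx_norm (u - v).
  apply: le_trans (fC u v) _; apply: (@le_trans _ _ (`|C| * norm1 (u - v))).
    by rewrite ler_wpM2r ?norm1_ge0 // ler_norm.
  have := C'n (u - v); rewrite mul1mx => h.
  apply: le_trans (ler_wpM2l (normr_ge0 C) h) _.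
  by rewrite mulrA ler_wpM2r ?mx_norm_ge0 // lerDl.
apply/nbhs_ballP; exists (e / K) => /=; first by rewrite divr_gt0.
move=> t; rewrite mx_norm_ball /ball_ /= => xt; apply: eS; rewrite /ball /=.
have {}xt : K * mx_norm (x - t) < e by rewrite mulrC -ltr_pdivlMr.
apply: le_lt_trans xt; rewrite ler_norml fle andbT lerNl opprB.
by rewrite (le_trans (fle t x)) // -[t - x]opprB mx_normN.
Qed.

Lemma trmx_continuous : continuous (fun u : 'rV[R]_p => u^T : 'cV[R]_p).
Proof.
move=> x S /nbhs_ballP [e /= e0 eS].
apply/nbhs_ballP; exists e => //= t; rewrite mx_norm_ball /ball_ /= => xt.
apply: eS; rewrite mx_norm_ball /ball_ /=.
apply: le_lt_trans xt; rewrite -linearB /=; apply: mx_norm_le => [|i].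
  exact: normr_ge0.
rewrite mxE [leRHS]/Num.norm /= mx_normrE.
exact: (le_bigmax _ (fun ij => `|(x - t) ij.1 ij.2|) (0, i)).
Qed.

(** The extreme value theorem is applied to row vectors, after pulling [K] and [f] back along
    transposition. *)
Lemma closed_bounded_min (K : set 'cV[R]_p) (f : 'cV[R]_p -> R) (B : R) :
  K !=set0 -> closed K -> (forall u, K u -> norm1 u <= B) -> continuous f ->
  exists2 u, K u & forall v, K v -> f u <= f v.
Proof.
move=> [u0 Ku0] clK KB cf.
pose K' : set 'rV[R]_p := [set u | K u^T].
have clK' : closed K'.
  by apply: (closed_comp (f := fun u : 'rV[R]_p => u^T)) => // u _; exact: trmx_continuous.
have bK' : bounded_set K'.
  exists B; split=> [|M BM u /KB uB]; first exact: num_real.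
  rewrite /Num.norm /= mx_normrE; apply/bigmax_leP; split=> [|[i j] _].
    by apply: le_trans (norm1_ge0 _) (le_trans uB (ltW BM)).
  apply: le_trans (ltW BM); apply: le_trans uB; rewrite ord1 /=.
  by have := entry_le_norm1 u^T j; rewrite mxE.
have cK' := bounded_closed_compact bK' clK'.
have [||c] := EVT_min_rV (f := fun u : 'rV[R]_p => f u^T) _ cK'.
- by exists u0^T; rewrite /K' /= trmxK.
- apply: continuous_subspaceT => u.
  apply: (@continuous_comp _ _ _ (fun u : 'rV[R]_p => u^T) f); last exact: cf.
  exact: trmx_continuous.
rewrite inE => Kc cmin; exists c^T => // v Kv.
by have := cmin v^T; rewrite trmxK; apply; rewrite inE /K' /= trmxK.
Qed.

Lemma norm2_continuous (x : 'cV[R]_p) : continuous (fun u : 'cV[R]_p => norm2 (x - u)).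
Proof.
apply: (@lipschitz1_continuous _ 1) => u v; rewrite mul1r lerBlDr norm1_distC.
apply: (@le_trans _ _ (norm2 (v - u) + norm2 (x - v))).
  by apply: le_trans (norm2D _ _); rewrite [v - u + _]addrC addrA subrK.
by rewrite lerD2r norm2_le_norm1.
Qed.

Lemma sublevel_closed (f : 'cV[R]_p -> R) (t : R) :
  continuous f -> closed [set u | f u <= t].
Proof.
by move=> cf; apply: (closed_comp (f := f) (D := [set s | s <= t])) => [u _|];
  [exact: cf|exact: closed_le].
Qed.

(** Only points at least as close to [x] as some fixed [u0] in [K] compete, and these form a closed
    bounded set. *)
Lemma projection_exists (K : set 'cV[R]_p) (x : 'cV[R]_p) :
  K !=set0 -> closed K ->
  exists2 u, K u & forall v, K v -> norm2 (x - u) <= norm2 (x - v).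
Proof.
move=> [u0 Ku0] clK; pose t := norm2 (x - u0).
pose K' := K `&` [set u | norm2 (x - u) <= t].
have [|||u [Ku ut] umin] := @closed_bounded_min K' (fun u : 'cV[R]_p => norm2 (x - u))
    (\sum_(i < p) (t + norm1 x)) _ _ _ (@norm2_continuous x).
- by exists u0; split=> //=.
- by apply: closedI => //; apply: sublevel_closed; exact: norm2_continuous.
- move=> u [_ /= ut]; apply: ler_sum => i _.
  have -> : u i 0 = x i 0 - (x - u) i 0 by rewrite !mxE; ring.
  apply: le_trans (ler_normB _ _) _; rewrite addrC.
  apply: lerD; last exact: entry_le_norm1.
  by apply: le_trans ut; apply: entry_le_norm2.
exists u => // v Kv; case: (leP (norm2 (x - v)) t) => [vt|/ltW vt].
  by apply: umin; split.
exact: le_trans vt.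
Qed.

End Compactness.

(** * Robinson's error bound *)

(** The l1 norm of the positive part, measuring by how much a system of inequalities is violated. *)
Definition pos_sum {R : realType} {p} (v : 'cV[R]_p) : R :=
  \sum_i Num.max (v i 0) 0.

Lemma pos_sum_ge0 {R : realType} {p} (v : 'cV[R]_p) : 0 <= pos_sum v.
Proof. by apply: sumr_ge0 => i _; rewrite le_max lexx orbT. Qed.

Lemma pos_sum_col_mx {R : realType} {p1 p2} (a : 'cV[R]_p1) (b : 'cV[R]_p2) :
  pos_sum (col_mx a b) = pos_sum a + pos_sum b.
Proof.
by rewrite /pos_sum big_split_ord /=; congr (_ + _); apply: eq_bigr => i _;
  rewrite ?col_mxEu ?col_mxEd.
Qed.

Lemma norm1_col_mx {R : realType} {p1 p2} (a : 'cV[R]_p1) (b : 'cV[R]_p2) :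
  norm1 (col_mx a b) = norm1 a + norm1 b.
Proof.
by rewrite /norm1 big_split_ord /=; congr (_ + _); apply: eq_bigr => i _;
  rewrite ?col_mxEu ?col_mxEd.
Qed.

Section RobinsonMu.
Context {R : realType} {p1 p2 r : nat}.
Variables (M1 : 'M[R]_(p1, r)) (M2 : 'M[R]_(p2, r)).

Local Notation mu_oo2 := (robinson_mu family_oo family_2 M1 M2).

Local Notation mu_set := [set inf [set family_oo u | u in solves M1 M2 d] |
       d in [set d : 'cV[R]_p1 * 'cV[R]_p2 | (exists u, solves M1 M2 d u) /\
                     family_2 (col_mx d.1 d.2) <= 1]].

Lemma inf_solution_norm_ge0 (d : 'cV[R]_p1 * 'cV[R]_p2) :
  0 <= inf [set family_oo u | u in solves M1 M2 d].
Proof.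
have [->|/set0P ne] := eqVneq [set family_oo u | u in solves M1 M2 d] set0.
  by rewrite inf0.
by apply: lb_le_inf => // _ [u _ <-]; exact: mx_norm_ge0.
Qed.

(** Makes the supremum in [robinson_mu] a genuine one: with the equations written as pairs of
    inequalities, [bounded_solution] gives one bound for all right-hand sides in the unit ball. *)
Lemma robinson_mu_ubound : has_ubound mu_set.
Proof.
have [C [C0 HC]] := bounded_solution (col_mx M1 (col_mx M2 (- M2))).
exists C => _ [[d1 d2] [[u [/= u1 u2]] d_le1] <-].
have dle i : `|(col_mx d1 d2) i 0| <= 1.
  exact: le_trans (entry_le_norm2 _ i) d_le1.
have [||w []] := HC (col_mx d1 (col_mx d2 (- d2))) 1.
- move=> i; case: (split_ordP i) => j ->.
    by rewrite col_mxEu; have := dle (lshift _ j); rewrite col_mxEu.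
  rewrite col_mxEd; case: (split_ordP j) => l ->.
    by rewrite col_mxEu; have := dle (rshift _ l); rewrite col_mxEd.
  by rewrite col_mxEd mxE normrN; have := dle (rshift _ l); rewrite col_mxEd.
- exists u; rewrite !mul_col_mx; apply/lev_col_mx; split=> //.
  by apply/lev_col_mx; rewrite mulNmx u2; split=> i.
rewrite !mul_col_mx => /lev_col_mx[w1 /lev_col_mx[w2 w3]] wC.
have wd : solves M1 M2 (d1, d2) w.
  split=> //=; apply/colP => i; apply/eqP; rewrite eq_le w2 /=.
  by have := w3 i; rewrite mulNmx !mxE lerN2.
apply: (@le_trans _ _ (family_oo w)); last first.
  by apply: mx_norm_le => // i; rewrite -[C]mulr1.
apply: ge_inf; last by exists w.
by exists 0 => _ [z _ <-]; exact: mx_norm_ge0.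
Qed.

Lemma robinson_mu_ge0 : 0 <= mu_oo2.
Proof.
have z0 : mu_set (inf [set family_oo u | u in solves M1 M2 (0, 0)]).
  exists (0, 0) => //=; split; first by exists 0; split; rewrite /= mulmx0.
  by rewrite col_mx0 /family_2 -(scale0r 0) norm2Z // mul0r ler01.
exact: le_trans (inf_solution_norm_ge0 _) (ub_le_sup robinson_mu_ubound z0).
Qed.

(** By homogeneity [d] is scaled to norm 1 and the solution scaled back; a zero [d] is solved by 0.
    The slack [eta] replaces attainment of the infimum over solutions. *)
Lemma robinson_mu_solution (d : 'cV[R]_p1 * 'cV[R]_p2) (eta : R) :
  0 < eta -> (exists u, solves M1 M2 d u) ->
  exists2 u, solves M1 M2 d u
    & mx_norm u <= (mu_oo2 + eta) * norm2 (col_mx d.1 d.2).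
Proof.
case: d => d1 d2 /= eta0 [u0 [/= u1 u2]].
have [n0|n0] := eqVneq (norm2 (col_mx d1 d2)) 0.
  have := norm2_eq0 n0; rewrite -[0 in X in X -> _](col_mx0 _ p1 p2) => /eq_col_mx[d10 d20].
  exists 0; last by rewrite n0 mulr0 mx_norm0.
  by split; rewrite mulmx0 /= ?d10 ?d20.
have np : 0 < norm2 (col_mx d1 d2) by rewrite lt_def n0 norm2_ge0.
set t := norm2 _ in np *; have t0 : 0 <= t^-1 by rewrite invr_ge0 ltW.
have lev_scale p (s : R) (a b : 'cV[R]_p) : 0 <= s -> lev a b -> lev (s *: a) (s *: b).
  by move=> s0 ab i; rewrite !mxE ler_wpM2l.
pose d' := (t^-1 *: d1, t^-1 *: d2).
have hd : [set d : 'cV[R]_p1 * 'cV[R]_p2 | (exists u, solves M1 M2 d u) /\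
                     family_2 (col_mx d.1 d.2) <= 1] d'.
  split.
    exists (t^-1 *: u0); split; rewrite /= -scalemxAr; first exact: lev_scale.
    by rewrite u2.
  by rewrite /= -scale_col_mx /family_2 norm2Z // mulVf // gt_eqF.
have hle : inf [set family_oo u | u in solves M1 M2 d'] <= mu_oo2.
  by apply: ub_le_sup; [exact: robinson_mu_ubound|exists d'].
have hinf : has_inf [set family_oo u | u in solves M1 M2 d'].
  split; last by exists 0 => _ [z _ <-]; exact: mx_norm_ge0.
  by case: hd => -[z hz] _; exists (family_oo z), z.
have [_ [u [/= w1 w2] <-] uinf] := inf_adherent eta0 hinf.
exists (t *: u).
  have tK : t * t^-1 = 1 by rewrite divff // gt_eqF.
  split; rewrite /= -scalemxAr.
    rewrite -[d1]scale1r -tK -scalerA; apply: lev_scale => //.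
    exact: ltW.
  by rewrite w2 scalerA tK scale1r.
have -> : mx_norm (t *: u) = t * mx_norm u.
  by have := mx_normZ t u; rewrite (ger0_norm (ltW np)).
rewrite mulrC ler_wpM2r ?(ltW np) //; apply: le_trans (ltW uinf) _.
by rewrite lerD2r.
Qed.

End RobinsonMu.

Section RobinsonBound.
Context {R : realType} {m1 m2 l : nat}.
Variables (N1 : 'M[R]_(m1, l)) (N2 : 'M[R]_(m2, l)).

Local Notation sigma := (robinson_sigma family_oo family_2 N1 N2).

(** There are finitely many nonnegative constants, so their sum bounds the supremum. *)
Lemma robinson_sigma_ge (S : {set 'I_m1}) :
  robinson_mu family_oo family_2
    (block_mx (rowsub (fun i : 'I_#|S| => enum_val i) 1%:M)
              (0 : 'M[R]_(#|S|, m2)) (- 1%:M) (0 : 'M[R]_(m1, m2)))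
    (col_mx N1 N2)^T <= sigma.
Proof.
pose F (S : {set 'I_m1}) := robinson_mu family_oo family_2
  (block_mx (rowsub (fun i : 'I_#|S| => enum_val i) 1%:M)
            (0 : 'M[R]_(#|S|, m2)) (- 1%:M) (0 : 'M[R]_(m1, m2)))
  (col_mx N1 N2)^T.
apply: ub_le_sup; last by exists S.
exists (\sum_S F S) => _ [S' _ <-]; rewrite -/(F S') (bigD1 S') //= lerDl.
by apply: sumr_ge0 => S'' _; exact: robinson_mu_ge0.
Qed.

Lemma robinson_sigma_ge0 : 0 <= sigma.
Proof. exact: le_trans (robinson_mu_ge0 _ _) (robinson_sigma_ge finset.set0). Qed.

(** The system inside Robinson's constant, taken with right-hand side [(0, v)], describes exactly
    the nonnegative multipliers vanishing on [S] that generate [v]. Hence some such representation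
    has size controlled by [sigma]. *)
Lemma bounded_multipliers (S : {set 'I_m1}) (v : 'cV[R]_l)
    (lam : 'cV[R]_m1) (nu : 'cV[R]_m2) (eta : R) :
  0 < eta -> lev 0 lam -> (forall i, i \in S -> lam i 0 = 0) ->
  v = N1^T *m lam + N2^T *m nu ->
  exists (lam' : 'cV[R]_m1) (nu' : 'cV[R]_m2),
  [/\ lev 0 lam', forall i, i \in S -> lam' i 0 = 0,
      v = N1^T *m lam' + N2^T *m nu'
    & [/\ forall i, `|lam' i 0| <= (sigma + eta) * norm2 v
       & forall i, `|nu' i 0| <= (sigma + eta) * norm2 v]].
Proof.
move=> eta0 lam0 lamS vE.
pose M1 := block_mx (rowsub (fun i : 'I_#|S| => enum_val i) 1%:M)
            (0 : 'M[R]_(#|S|, m2)) (- 1%:M) (0 : 'M[R]_(m1, m2)).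
have M1E (a : 'cV_m1) (b : 'cV_m2) :
    M1 *m col_mx a b = col_mx (rowsub (fun i : 'I_#|S| => enum_val i) a) (- a).
  by rewrite mul_block_col !mul0mx !addr0 mul_rowsub_mx mul1mx mulNmx mul1mx.
have M2E (a : 'cV_m1) (b : 'cV_m2) :
    (col_mx N1 N2)^T *m col_mx a b = N1^T *m a + N2^T *m b.
  by rewrite tr_col_mx mul_row_col.
have solE (a : 'cV_m1) (b : 'cV_m2) :
    solves M1 (col_mx N1 N2)^T (0, v) (col_mx a b) <->
    [/\ lev 0 a, forall i, i \in S -> a i 0 <= 0 & v = N1^T *m a + N2^T *m b].
  rewrite /solves /= M1E M2E -[0 : 'cV_(_ + _)]col_mx0; split.
    case=> /lev_col_mx[h1 h2] <-; split=> // i.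
      by have := h2 i; rewrite !mxE oppr_le0.
    by move=> iS; have := h1 (enum_rank_in iS i); rewrite !mxE enum_rankK_in.
  case=> h1 h2 ->; split=> //; apply/lev_col_mx; split=> i.
    by rewrite !mxE h2 // enum_valP.
  by have := h1 i; rewrite !mxE oppr_le0.
have [|u usol ule] := robinson_mu_solution (M1 := M1) (M2 := (col_mx N1 N2)^T)
    (d := (0, v)) eta0.
  by exists (col_mx lam nu); apply/solE; split=> // i iS; rewrite lamS.
rewrite -[u]vsubmxK in usol ule.
have [h1 h2 h3] := (solE _ _).1 usol.
have n2 : norm2 (col_mx (0 : 'cV[R]_(#|S| + m1)) v) = norm2 v.
  congr Num.sqrt; rewrite big_split_ord /= big1 ?add0r => [|i _].
    by apply: eq_bigr => i _; rewrite col_mxEd.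
  by rewrite col_mxEu mxE expr0n.
have uB i : `|(col_mx (usubmx u) (dsubmx u)) i 0| <= (sigma + eta) * norm2 v.
  apply: le_trans (entry_le_mx_norm _ _) _; apply: le_trans ule _.
  rewrite n2 ler_wpM2r ?norm2_ge0 // lerD2r; exact: robinson_sigma_ge.
exists (usubmx u), (dsubmx u); split=> //.
  move=> i iS; apply/eqP; rewrite eq_le h2 //=.
  by have := h1 i; rewrite [leLHS]mxE.
by split=> i; [have := uB (lshift _ i); rewrite col_mxEu
              |have := uB (rshift _ i); rewrite col_mxEd].
Qed.

(* Either the active normals generate x - xs, or by Farkas a feasible
   direction of descent for the distance to x exists. *)
Lemma projection_multipliers (d1 : 'cV[R]_m1) (d2 : 'cV[R]_m2) (x xs : 'cV[R]_l) :
  lev (N1 *m xs) d1 -> N2 *m xs = d2 ->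
  (forall z, lev (N1 *m z) d1 -> N2 *m z = d2 -> norm2 (x - xs) <= norm2 (x - z)) ->
  exists (lam : 'cV[R]_m1) (nu : 'cV[R]_m2),
  [/\ lev 0 lam, forall i, (N1 *m xs) i 0 < d1 i 0 -> lam i 0 = 0
    & x - xs = N1^T *m lam + N2^T *m nu].
Proof.
move=> xs1 xs2 xsmin; set v := x - xs.
(* Inactive rows are zeroed rather than removed, so multipliers keep the index set of [N1]. *)
pose act : 'rV[R]_m1 := \row_i ((N1 *m xs) i 0 == d1 i 0)%:R.
pose D1 := diag_mx act *m N1.
have D1E z i : (D1 *m z) i 0 = act 0 i * (N1 *m z) i 0.
  by rewrite -mulmxA mul_diag_mx mxE.
(* The last row normalises the strict descent condition to [1 <= dotv v d]; the rows [N2] and [- N2]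
   together force [N2 d = 0]. *)
case: (farkas (col_mx D1 (col_mx N2 (col_mx (- N2) (- v^T))))
         (col_mx 0 (col_mx 0 (col_mx 0 (-1)%:M)))) => [[d]|].
  rewrite !mul_col_mx => /lev_col_mx[h1 /lev_col_mx[h2 /lev_col_mx[h3 h4]]].
  exfalso.
  have vd : 1 <= dotv v d.
    by have := h4 0; rewrite mulNmx [leLHS]mxE [leRHS]mxE eqxx mulr1n lerN2.
  have N2d : N2 *m d = 0.
    apply/colP => i; apply/eqP; rewrite eq_le h2 /=.
    by have := h3 i; rewrite mulNmx !mxE oppr_le0.
  pose s i := d1 i 0 - (N1 *m xs) i 0.
  have s0 i : 0 <= s i by rewrite subr_ge0.
  (* The step length [T^-1] is small enough to stay within the slack of every inactive row, and to
     keep the quadratic term of the squared distance below the linear gain. Active rows have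
     [s i = 0] and contribute 0 to the sum. *)
  pose T := 1 + \sum_i `|(N1 *m d) i 0| / s i + norm2 d ^+ 2.
  have S0 : 0 <= \sum_i `|(N1 *m d) i 0| / s i.
    by apply: sumr_ge0 => i _; rewrite divr_ge0.
  have T0 : 0 < T by rewrite /T; have := sqr_ge0 (norm2 d); lra.
  have t0 : 0 < T^-1 by rewrite invr_gt0.
  have := xsmin (xs + T^-1 *: d).
  rewrite !mulmxDr -!scalemxAr N2d scaler0 addr0 => /(_ _ xs2) h.
  have {h} : norm2 v <= norm2 (v - T^-1 *: d).
    rewrite /v -addrA -opprD; apply: h => i; rewrite [leLHS]mxE -lerBrDl [leLHS]mxE -/(s i).
    have := s0 i; rewrite le_eqVlt => /orP[/eqP si|si].
      rewrite -si; apply: mulr_ge0_le0; first exact: ltW.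
      have := h1 i; rewrite D1E mxE [leRHS]mxE.
      have -> : (N1 *m xs) i 0 == d1 i 0 by rewrite eq_sym -subr_eq0 -/(s i) -si.
      by rewrite mul1r.
    apply: (@le_trans _ _ (T^-1 * `|(N1 *m d) i 0|)).
      by rewrite ler_wpM2l ?ler_norm // ltW.
    rewrite mulrC ler_pdivrMr // mulrC -ler_pdivrMr //.
    rewrite /T (bigD1 i) //=.
    set rest := \sum_(_ | _) _; have : 0 <= rest.
      by apply: sumr_ge0 => j _; rewrite divr_ge0.
    by have := sqr_ge0 (norm2 d); lra.
  clearbody v; rewrite -(@ler_pXn2r _ 2) ?nnegrE ?norm2_ge0 // [leRHS]norm2_sqr.
  rewrite dotvBr !(dotvC (v - _)) !dotvBr !dotvZl !dotvZr -!norm2_sqr (dotvC d v).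
  have hd : T^-1 * norm2 d ^+ 2 <= 1.
    by rewrite mulrC ler_pdivrMr // mul1r /T; lra.
  move: (norm2 d ^+ 2) (dotv v d) (norm2 v ^+ 2) T^-1 vd t0 hd => a b c t.
  by move=> b1 tp ta; nra.
move=> [w []]; rewrite -[w]vsubmxK; move: (usubmx w) (dsubmx w) => l1 {}w.
rewrite -[w]vsubmxK; move: (usubmx w) (dsubmx w) => l2 {}w.
rewrite -[w]vsubmxK; move: (usubmx w) (dsubmx w) => l3 {}w.
rewrite [w]mx11_scalar; move: (w 0 0) => {w} th.
rewrite -[0 : 'cV_(_ + _)]col_mx0 => /lev_col_mx[l10 _].
rewrite !tr_col_mx !mul_row_col !dotv_col_mx !dotv0r !add0r.
have -> : dotv th%:M (-1)%:M = - th.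
  by rewrite dotvE big_ord1 !mxE mulrN mulr1.
rewrite oppr_lt0 !trmxN trmxK !mulNmx mul_mx_scalar trmx_mul tr_diag_mx -mulmxA.
move=> lE th0; have thK : th^-1 * th = 1 by rewrite mulVf // gt_eqF.
have {}lE : th *: v = N1^T *m (diag_mx act *m l1) + N2^T *m (l2 - l3).
  apply/esym/eqP; rewrite -subr_eq0 -lE mulmxBr; apply/eqP.
  by rewrite !addrA.
exists (th^-1 *: (diag_mx act *m l1)), (th^-1 *: (l2 - l3)); split.
- move=> i; rewrite mul_diag_mx !mxE; do ?[apply: mulr_ge0 => //].
    by rewrite invr_ge0 ltW.
  by have := l10 i; rewrite mxE.
- by move=> i /lt_eqF neq; rewrite mul_diag_mx !mxE; rewrite mxE in neq;
    rewrite neq mul0r mulr0.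
by rewrite -!scalemxAr -scalerDr -lE scalerA thK scale1r.
Qed.

(** Project [x] onto the solution set and write the error [v] with bounded multipliers. Pairing [v]
    with itself bounds its squared norm by [sigma] times its norm times the residual, up to [eta];
    dividing by the norm finishes. *)
Theorem robinson_error_bound (d1 : 'cV[R]_m1) (d2 : 'cV[R]_m2) (x : 'cV[R]_l) :
  (exists z, solves N1 N2 (d1, d2) z) ->
  exists2 xs, solves N1 N2 (d1, d2) xs
    & norm2 (x - xs) <= sigma * (pos_sum (N1 *m x - d1) + norm1 (N2 *m x - d2)).
Proof.
move=> [z0 [/= z1 z2]].
have [C1 C10 C1n] := mulmx_norm1_bounded N1.
have [C2 C20 C2n] := mulmx_norm1_bounded N2.
(* The solution set is a sublevel set of the residual, which is Lipschitz in the l1 norm. *)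
have clK : closed (solves N1 N2 (d1, d2)).
  pose f z := pos_sum (N1 *m z - d1) + norm1 (N2 *m z - d2).
  rewrite (_ : solves _ _ _ = [set z | f z <= 0]).
    apply/sublevel_closed/(@lipschitz1_continuous _ _ _ (C1 + C2)) => u v.
    apply: (@le_trans _ _ (norm1 (N1 *m (u - v)) + norm1 (N2 *m (u - v)))).
      rewrite /f opprD addrACA; apply: lerD.
        rewrite /pos_sum -sumrB; apply: ler_sum => i _.
        rewrite mulmxBr !mxE !maxEle.
        by do 2 case: ifP => ?; case: ler0P; lra.
      rewrite lerBlDr (le_trans _ (norm1D _ _)) // mulmxBr.
      by rewrite addrA subrK.
    by rewrite mulrDl lerD.
  apply/seteqP; split=> z /=.
    case=> h1 h2; rewrite /f /= h2 subrr /norm1 /pos_sum !big1 ?addr0 // => i _.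
      by rewrite mxE normr0.
    by apply: max_r; have := h1 i; rewrite !mxE subr_le0.
  rewrite /f => fz; have p1 := pos_sum_ge0 (N1 *m z - d1).
  have p2 := norm1_ge0 (N2 *m z - d2).
  have {p2} n2 : norm1 (N2 *m z - d2) = 0 by lra.
  have {p1 fz} : pos_sum (N1 *m z - d1) <= 0 by lra.
  move=> ps; split=> /= [i|]; last first.
    apply/colP => i; apply/eqP; rewrite -subr_eq0 -normr_le0 -n2.
    by apply: le_trans (entry_le_norm1 _ i); rewrite !mxE.
  rewrite -subr_le0; apply: le_trans ps; rewrite /pos_sum (bigD1 i) //=.
  apply: (@le_trans _ _ (Num.max ((N1 *m z - d1) i 0) 0)).
    by rewrite !mxE le_max lexx.
  by rewrite lerDl; apply: sumr_ge0 => j _; rewrite le_max lexx orbT.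
have ne : solves N1 N2 (d1, d2) !=set0 by exists z0.
have [xs [/= xs1 xs2] xsmin] := projection_exists x ne clK.
exists xs; first by split.
have [|lam [nu [lam0 lamS vE]]] := @projection_multipliers d1 d2 x xs xs1 xs2.
  by move=> z h1 h2; apply: xsmin; split.
set v := x - xs in vE *.
set res := pos_sum _ + _; have res0 : 0 <= res.
  by rewrite addr_ge0 ?pos_sum_ge0 ?norm1_ge0.
(* [eta] is chosen so that [eta * res <= e]; the [+ 1] keeps the quotient meaningful when the
   residual is 0. *)
apply/ler_addgt0Pr => e e0; pose eta := e / (res + 1).
have r1 : 0 < res + 1 by rewrite ltr_wpDl.
have eta0 : 0 < eta by rewrite divr_gt0.
pose S := [set i | (N1 *m xs) i 0 < d1 i 0]%SET.
have [|lam' [nu' [lam'0 lam'S vE' [lamB nuB]]]] :=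
    @bounded_multipliers S v lam nu eta eta0 lam0 _ vE.
  by move=> i; rewrite inE; exact: lamS.
have K0 : 0 <= (sigma + eta) * norm2 v.
  by rewrite mulr_ge0 ?norm2_ge0 // addr_ge0 ?robinson_sigma_ge0 // ltW.
(* On an active row [N1 v] is at most the residual of [x]; on an inactive row the multiplier is 0.
   The equality rows of [N2 v] are exactly the residual. *)
have vv : norm2 v ^+ 2 <= (sigma + eta) * norm2 v * res.
  have -> : norm2 v ^+ 2 = dotv lam' (N1 *m v) + dotv nu' (N2 *m v).
    by rewrite !dotv_mulmx !(dotvC _ v) -dotvDr -vE' norm2_sqr.
  rewrite /res mulrDr; apply: lerD.
    rewrite dotvE /pos_sum mulr_sumr; apply: ler_sum => i _.
    have l0 : 0 <= lam' i 0 by have := lam'0 i; rewrite mxE.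
    have m0 : 0 <= Num.max ((N1 *m x - d1) i 0) 0 by rewrite le_max lexx orbT.
    case: (boolP (i \in S)) => iS; first by rewrite lam'S // mul0r mulr_ge0.
    apply: (@le_trans _ _ (lam' i 0 * Num.max ((N1 *m x - d1) i 0) 0)).
      apply: ler_wpM2l => //; rewrite le_max; apply/orP; left.
      rewrite inE -leNgt in iS; rewrite /v mulmxBr !mxE lerD2l lerN2.
      by rewrite mxE in iS.
    by apply: ler_wpM2r => //; apply: le_trans (ler_norm _) (lamB i).
  apply: le_trans (ler_norm _) _.
  apply: le_trans (dotv_abs_le _ nuB) _.
  by rewrite /v mulmxBr xs2.
have [v0|v0] := eqVneq (norm2 v) 0.
  by rewrite v0 addr_ge0 ?(ltW e0) // mulr_ge0 // robinson_sigma_ge0.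
have vp : 0 < norm2 v by rewrite lt_def v0 norm2_ge0.
have : norm2 v <= (sigma + eta) * res.
  by rewrite -(ler_pM2l vp); apply: le_trans (le_trans _ vv) _;
    rewrite ?expr2 // mulrA [norm2 v * _]mulrC.
move=> h; apply: le_trans h _; rewrite mulrDl lerD2l /eta mulrAC.
by rewrite ler_pdivrMr // ler_wpM2l ?(ltW e0) // lerDl.
Qed.

End RobinsonBound.

(** * Dual norm, sparse certificates and the constant c *)

Section DualNorm.
Context {R : realType} {q : nat}.
Variables (phi : 'cV[R]_q -> R).
Hypothesis phi_norm : is_norm phi.

Lemma is_norm_opp z : phi (- z) = phi z.
Proof. by have [_ hom _] := phi_norm; rewrite -scaleN1r hom normrN1 mul1r. Qed.

Lemma is_norm_ge0 z : 0 <= phi z.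
Proof.
have [tri hom _] := phi_norm.
have := tri z (- z); rewrite is_norm_opp subrr -(scale0r 0) hom normr0 mul0r.
by rewrite -mulr2n pmulrn_lge0.
Qed.

(* If the supremum defining the dual norm did not exist, its value would be
   the junk value 0. *)
Lemma dotv_le_norm a z : dual_norm phi a = 1 -> dotv a z <= phi z.
Proof.
move=> a1; have [_ hom sep] := phi_norm.
have hs : has_sup [set dotv a x | x in unit_ball phi].
  apply: contrapT => /sup_out; rewrite -/(dual_norm phi a) a1 => /eqP.
  by rewrite oner_eq0.
have [z0|z0] := eqVneq (phi z) 0; first by rewrite z0 (sep _ z0) dotv0r.
have zp : 0 < phi z by rewrite lt_def z0 is_norm_ge0.
have h : dotv a ((phi z)^-1 *: z) <= 1.
  rewrite -a1; apply: (sup_upper_bound hs); exists ((phi z)^-1 *: z) => //.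
  by rewrite /unit_ball /= hom normfV gtr0_norm // mulVf // gt_eqF.
by move: h; rewrite dotvZr mulrC ler_pdivrMr // mul1r.
Qed.

Lemma norm_le_norm1 (phi1 : forall i, phi (basisv i) = 1) z : phi z <= norm1 z.
Proof.
have [tri hom _] := phi_norm.
have zE : z = \sum_i z i 0 *: basisv i.
  apply/colP => k; rewrite summxE (bigD1 k) //= big1 => [|i ik].
    by rewrite !mxE !eqxx mulr1 addr0.
  by rewrite !mxE eq_sym (negbTE ik) mulr0.
rewrite {1}zE /norm1; elim/big_rec2 : _ => [|i a b _ ab].
  by rewrite -(scale0r 0) hom normr0 mul0r.
by rewrite (le_trans (tri _ _)) // hom phi1 mulr1 lerD2l.
Qed.

End DualNorm.

Section SparseCertificate.
Context {R : realType} {m n : nat}.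
Variables (A : 'M[R]_(m, n)) (k : nat).

(** The infimum over sparse vectors reduces to finitely many supports: off its support, a sparse [u]
    already leaves the full mass of [x] as error. *)
Lemma best_approx1_support (x : 'cV[R]_n) :
  exists2 T : {set 'I_n}, (#|T| <= k)%N
    & \sum_(i | i \notin T) `|x i 0| <= best_approx1 k x.
Proof.
pose F (T : {set 'I_n}) := \sum_(i | i \notin T) `|x i 0|.
have k0 : (#|(finset.set0 : {set 'I_n})| <= k)%N by rewrite cards0.
have [T Tk Tmin] := @Order.TotalTheory.arg_minP _ _ _ finset.set0
  (fun T : {set 'I_n} => (#|T| <= k)%N) F k0.
exists T => //; apply: lb_le_inf.
  exists (norm1 (x - 0)); exists 0 => //=.
  by rewrite /norm0 eq_card0 // => i; rewrite inE mxE eqxx.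
move=> _ [u /= uk <-].
apply: (@le_trans _ _ (F [set i | u i 0 != 0]%SET)).
  by apply: Tmin; apply: leq_trans uk; rewrite cardsE.
rewrite /F big_mkcond /=; apply: ler_sum => i _; rewrite inE negbK.
by case: eqP => [ui|_] //; rewrite !mxE ui subr0.
Qed.

(** The RSP is applied to the sign pattern of [x] on a best support [T]. Nothing is lost on [T], and
    each entry outside loses at most twice its modulus. *)
Lemma weak_RSP_certificate (x : 'cV[R]_n) : weak_RSP A k ->
  exists g : 'cV[R]_m, (forall i, `|(A^T *m g) i 0| <= 1) /\
    norm1 x - dotv (A^T *m g) x <= 2 * best_approx1 k x.
Proof.
move=> rsp; have [T Tk Tx] := best_approx1_support x.
pose X := [set i | 0 <= x i 0]%SET.
have [||zeta [[g ->] z1 z2 z3]] := rsp (T :&: X)%SET (T :\: X)%SET.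
- rewrite -setI_eq0; apply/eqP/setP => i; rewrite !inE.
  by case: (0 <= x i 0); rewrite ?andbF.
- by rewrite cardsID.
exists g; split=> [i|].
  have [iS|/z3 //] := boolP (i \in (T :&: X) :|: (T :\: X))%SET.
  move: iS; rewrite finset.in_setU => /orP[/z1 ->|/z2 ->].
    by rewrite normr1.
  by rewrite normrN1.
apply: le_trans (ler_wpM2l _ Tx) => //.
rewrite dotvE /norm1 -sumrB mulr_sumr big_mkcond /= [leRHS]big_mkcond /=.
apply: ler_sum => i _; have [iT|iT] := boolP (i \in T) => /=.
  case: (boolP (i \in X)) => iX.
    have -> : (A^T *m g) i 0 = 1 by apply: z1; rewrite finset.in_setI iT.
    by rewrite inE in iX; rewrite mul1r ger0_norm ?subrr.
  have -> : (A^T *m g) i 0 = -1 by apply: z2; rewrite finset.in_setD iX.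
  rewrite inE -ltNge in iX; rewrite ltr0_norm //; lra.
have h : `|(A^T *m g) i 0 * x i 0| <= `|x i 0|.
  rewrite normrM -[leRHS]mul1r ler_wpM2r //; apply: z3.
  by rewrite !inE (negbTE iT) !andbF.
by have := ler_norm (- ((A^T *m g) i 0 * x i 0)); rewrite normrN; lra.
Qed.

End SparseCertificate.

Section ConstantC.
Context {R : realType} {m n q : nat}.
Variables (A : 'M[R]_(m, n)) (M : 'M[R]_(m, q)).

Lemma norm_oo_to_1_has_ub {p r} (Q : 'M[R]_(p, r)) :
  has_ubound [set norm1 (Q *m x) | x in [set x : 'cV[R]_r | mx_norm x <= 1]].
Proof.
have [C C0 QC] := mulmx_bounded Q; exists C => _ [x /= x1 <-].
by apply: le_trans (QC x) _; rewrite -[leRHS]mulr1 ler_wpM2l.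
Qed.

Lemma norm_oo_to_1_ge {p r} (Q : 'M[R]_(p, r)) (x : 'cV[R]_r) :
  (forall i, `|x i 0| <= 1) -> norm1 (Q *m x) <= norm_oo_to_1 Q.
Proof.
move=> x1; apply: ub_le_sup; first exact: norm_oo_to_1_has_ub.
by exists x => //=; apply: mx_norm_le.
Qed.

Lemma constant_c_ge (G : {set 'I_q}) (hG : #|G| = m) :
  cols_sub M hG \in unitmx ->
  norm_oo_to_1 (invmx (cols_sub M hG) *m invmx (A *m A^T) *m A) <= constant_c A M.
Proof.
move=> uG; apply: ub_le_sup; last by exists G, hG.
(* The set defining the constant is also indexed by proofs of the cardinality; [b] removes that
   dependence, so a finite sum over [G] bounds it. *)
have [b bP] : exists b : {set 'I_q} -> R, forall (G : {set 'I_q}) (hG : #|G| = m),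
    norm_oo_to_1 (invmx (cols_sub M hG) *m invmx (A *m A^T) *m A) <= b G.
  have [G'|b bP] := @fin_all_exists _ _ (fun (G : {set 'I_q}) b => forall hG : #|G| = m,
    norm_oo_to_1 (invmx (cols_sub M hG) *m invmx (A *m A^T) *m A) <= b).
    have [h|nh] := pselect (#|G'| = m); last by exists 0 => h; case: nh.
    exists (norm_oo_to_1 (invmx (cols_sub M h) *m invmx (A *m A^T) *m A)) => h'.
    by rewrite (Prop_irrelevance h h').
  by exists b.
exists (\sum_G `|b G|) => _ [G' [hG' [_ ->]]].
apply: le_trans (bP _ _) _; apply: le_trans (ler_norm _) _.
by rewrite (bigD1 G') //= lerDl sumr_ge0.
Qed.

(** A row vector [v] killed by the Gram matrix makes [v A] have norm 0, and [A] has independent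
    rows. *)
Lemma gram_unit : \rank A = m -> A *m A^T \in unitmx.
Proof.
move=> rA; rewrite -row_free_unit; apply: inj_row_free => v vA.
apply/eqP; rewrite -(mulmx_free_eq0 _ (B := A)); last by rewrite /row_free rA.
have : dotv ((v *m A)^T) ((v *m A)^T) = 0.
  by rewrite /dotv trmxK trmx_mul mulmxA -(mulmxA v) vA mul0mx mxE.
rewrite -norm2_sqr => /eqP; rewrite expf_eq0 /= => /eqP /norm2_eq0 h.
by rewrite -[v *m A]trmxK h trmx0.
Qed.

(** Full rank selects [m] independent columns. The enumeration of [G] may list them in another
    order, so invertibility is transferred through an inclusion of row spaces. *)
Lemma invertible_cols : \rank M = m ->
  exists (G : {set 'I_q}) (hG : #|G| = m), cols_sub M hG \in unitmx.
Proof.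
move=> rM; have fM : row_full M^T by rewrite /row_full mxrank_tr rM.
pose f := fullrankfun fM.
have hG : #|[set f i | i in [set: 'I_m]]%SET| = m.
  by rewrite finset.card_imset ?cardsT ?card_ord //; exact: fullrankfun_inj.
exists [set f i | i in [set: 'I_m]]%SET, hG.
rewrite -unitmx_tr -row_full_unit -sub1mx.
have /(submx_trans _) -> // : (rowsub f M^T <= (cols_sub M hG)^T)%MS.
  apply/row_subP => i.
  have fi : f i \in [set f i | i in [set: 'I_m]]%SET by apply: imset_f; rewrite inE.
  have -> : row i (rowsub f M^T) =
      row (cast_ord hG (enum_rank_in fi (f i))) (cols_sub M hG)^T.
    apply/rowP => j; rewrite !mxE castmxE !mxE /=; congr (M _ _).
      by apply: val_inj.
    by rewrite cast_ord_comp cast_ord_id enum_rankK_in.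
  exact: row_sub.
by apply: submx_full; exact: fullrowsub_full.
Qed.

(** [h] is supported on an invertible column set [G], with entries [M_G^-1 g]. Since
    [g = (A A^T)^-1 A (A^T g)] and [A^T g] lies in the sup-norm unit ball, its l1 norm is at most
    the operator norm for [G]. *)
Lemma preimage_norm1_le_c (g : 'cV[R]_m) : \rank A = m -> \rank M = m ->
  (forall i, `|(A^T *m g) i 0| <= 1) ->
  exists h : 'cV[R]_q, M *m h = g /\ norm1 h <= constant_c A M.
Proof.
move=> rA rM gle; have [G [hG uG]] := invertible_cols rM.
pose f (j : 'I_m) : 'I_q := enum_val (cast_ord (esym hG) j).
pose E : 'M[R]_(q, m) := \matrix_(i, j) (i == f j)%:R.
have ME : cols_sub M hG = M *m E.
  apply/matrixP => i j; rewrite castmxE !mxE.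
  rewrite (bigD1 (f j)) //= big1 ?addr0 => [|l lj].
    by rewrite mxE eqxx mulr1; congr (M _ _); apply: val_inj.
  by rewrite mxE (negbTE lj) mulr0.
pose v := invmx (cols_sub M hG) *m g.
exists (E *m v); split; first by rewrite mulmxA -ME mulKVmx.
apply: le_trans (constant_c_ge uG).
have -> : v = invmx (cols_sub M hG) *m invmx (A *m A^T) *m A *m (A^T *m g).
  by rewrite -!mulmxA (mulmxA A) mulKmx // gram_unit.
apply: le_trans _ (norm_oo_to_1_ge _ gle); move: (_ *m (A^T *m g)) => {}v.
apply: (@le_trans _ _ (\sum_i \sum_j (i == f j)%:R * `|v j 0|)).
  apply: ler_sum => i _; rewrite mxE; apply: le_trans (ler_norm_sum _ _ _) _.
  by apply: ler_sum => j _; rewrite mxE normrM normr_nat.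
rewrite exchange_big /=; apply: ler_sum => j _.
rewrite (bigD1 (f j)) //= eqxx mul1r big1 ?addr0 // => i /negbTE ->.
by rewrite mul0r.
Qed.

End ConstantC.

(** * The primal-dual system *)

Section HatSystem.
Context {R : realType} {m n q nhat : nat}.
Variables (A : 'M[R]_(m, n)) (M : 'M[R]_(m, q)) (y : 'cV[R]_m) (mu : R).
Variable Gam : 'M[R]_(q, nhat).

Local Notation B := (M *m Gam).
Local Notation en := (const_mx 1 : 'cV[R]_n).
Local Notation ehat := (const_mx 1 : 'cV[R]_nhat).

(** Primal variables are the point [x], bounds [t] on its moduli and the objective [rho]. The dual
    variables [w1], [w2], [w3], [w4] are the multipliers of [x <= t], [- x <= t], the bound [mu] on
    the sum of [t], and the polyhedral constraints. *)
Definition hat_vec (x t : 'cV[R]_n) (rho : 'cV[R]_1) (w1 w2 : 'cV[R]_n)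
    (w3 : 'cV[R]_1) (w4 : 'cV[R]_nhat) :=
  col_mx x (col_mx t (col_mx rho (col_mx w1 (col_mx w2 (col_mx w3 w4))))).

Definition hat_rhs :=
  col_mx (0 : 'cV[R]_n) (col_mx (0 : 'cV[R]_n) (col_mx (mu%:M : 'cV[R]_1)
  (col_mx (B^T *m y) (col_mx (0 : 'cV[R]_n) (col_mx (1%:M : 'cV[R]_1)
  (col_mx (0 : 'cV[R]_n) (col_mx (0 : 'cV[R]_1) (col_mx (0 : 'cV[R]_n)
  (col_mx (0 : 'cV[R]_n) (col_mx (0 : 'cV[R]_1) (0 : 'cV[R]_nhat))))))))))).

Lemma row7_hat_vec {p} (B1 B2 : 'M[R]_(p, n)) B3 (B4 B5 : 'M[R]_(p, n)) B6
    (B7 : 'M[R]_(p, nhat)) (x t : 'cV[R]_n) (rho : 'cV[R]_1) (w1 w2 : 'cV[R]_n)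
    (w3 : 'cV[R]_1) (w4 : 'cV[R]_nhat) :
  row7 B1 B2 B3 B4 B5 B6 B7 *m hat_vec x t rho w1 w2 w3 w4 =
  B1 *m x + (B2 *m t + (B3 *m rho + (B4 *m w1 + (B5 *m w2 + (B6 *m w3 + B7 *m w4))))).
Proof. by rewrite /row7 /hat_vec !mul_row_col. Qed.

Lemma Mhat1_hat_vec (x t : 'cV[R]_n) (rho : 'cV[R]_1) (w1 w2 : 'cV[R]_n)
    (w3 : 'cV[R]_1) (w4 : 'cV[R]_nhat) :
  Mhat1 A M Gam *m hat_vec x t rho w1 w2 w3 w4 =
  col_mx (x - t) (col_mx (- x - t) (col_mx (en^T *m t)
  (col_mx (B^T *m A *m x - ehat *m rho) (col_mx (w1 + (w2 - en *m w3))
  (col_mx (ehat^T *m w4) (col_mx (- t) (col_mx (- rho) (col_mx (- w1)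
  (col_mx (- w2) (col_mx (- w3) (- w4))))))))))).
Proof.
rewrite /Mhat1; cbv zeta; rewrite !mul_col_mx !row7_hat_vec.
by rewrite !mul0mx !mulNmx !mul1mx !(addr0, add0r).
Qed.

Lemma Mhat2_hat_vec (x t : 'cV[R]_n) (rho : 'cV[R]_1) (w1 w2 : 'cV[R]_n)
    (w3 : 'cV[R]_1) (w4 : 'cV[R]_nhat) :
  Mhat2 A M y mu Gam *m hat_vec x t rho w1 w2 w3 w4 =
  col_mx (w1 + (- w2 + A^T *m (B *m w4)))
         (rho + (mu *: w3 + y^T *m (B *m w4))).
Proof.
rewrite /Mhat2; cbv zeta; rewrite !mul_col_mx !row7_hat_vec.
by rewrite !mul0mx !mulNmx !mul1mx !(addr0, add0r) mul_scalar_mx -!mulmxA.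
Qed.

Lemma hat_vec_surj (z : 'cV[R]_(n + (n + (1 + (n + (n + (1 + nhat))))))) :
  exists x t rho w1 w2 w3 w4, z = hat_vec x t rho w1 w2 w3 w4.
Proof.
rewrite -[z]vsubmxK; move: (usubmx z) (dsubmx z) => x {}z; exists x.
rewrite -[z]vsubmxK; move: (usubmx z) (dsubmx z) => t {}z; exists t.
rewrite -[z]vsubmxK; move: (usubmx z) (dsubmx z) => rho {}z; exists rho.
rewrite -[z]vsubmxK; move: (usubmx z) (dsubmx z) => w1 {}z; exists w1.
rewrite -[z]vsubmxK; move: (usubmx z) (dsubmx z) => w2 {}z; exists w2.
rewrite -[z]vsubmxK; move: (usubmx z) (dsubmx z) => w3 w4.
by exists w3, w4.
Qed.

Definition hat_ineqs (x t : 'cV[R]_n) (rho : 'cV[R]_1) (w1 w2 : 'cV[R]_n)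
    (w3 : 'cV[R]_1) (w4 : 'cV[R]_nhat) :=
  [/\ lev (x - t) 0, lev (- x - t) 0, lev (en^T *m t) mu%:M,
      lev (B^T *m A *m x - ehat *m rho) (B^T *m y)
    & lev (w1 + (w2 - en *m w3)) 0] /\
  [/\ lev (ehat^T *m w4) 1%:M, lev (- t) 0, lev (- rho) 0 &
      [/\ lev (- w1) 0, lev (- w2) 0, lev (- w3) 0 & lev (- w4) 0]].

Lemma hat_lev (x t : 'cV[R]_n) (rho : 'cV[R]_1) (w1 w2 : 'cV[R]_n)
    (w3 : 'cV[R]_1) (w4 : 'cV[R]_nhat) :
  lev (Mhat1 A M Gam *m hat_vec x t rho w1 w2 w3 w4) hat_rhs <->
  hat_ineqs x t rho w1 w2 w3 w4.
Proof.
rewrite Mhat1_hat_vec /hat_rhs /hat_ineqs; split.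
  case/lev_col_mx=> ? /lev_col_mx[? /lev_col_mx[? /lev_col_mx[? /lev_col_mx[?]]]].
  by case/lev_col_mx=> ? /lev_col_mx[? /lev_col_mx[? /lev_col_mx[? /lev_col_mx[?]]]]
    /lev_col_mx[].
by case=> -[? ? ? ? ?] [? ? ? [? ? ? ?]]; do ?[apply/lev_col_mx; split].
Qed.

End HatSystem.

(** * Weak duality and solvability of the hat system *)

Section HatFeasibility.
Context {R : realType} {m n q nhat : nat}.
Variables (A : 'M[R]_(m, n)) (M : 'M[R]_(m, q)) (y : 'cV[R]_m) (mu : R).
Variables (phi : 'cV[R]_q -> R) (Gam : 'M[R]_(q, nhat)).
Hypothesis mu_gt0 : 0 < mu.
Hypothesis phi_norm : is_norm phi.
Hypothesis Gam_le : forall a z, dotv (col a Gam) z <= phi z.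

Local Notation B := (M *m Gam).
Local Notation en := (const_mx 1 : 'cV[R]_n).
Local Notation ehat := (const_mx 1 : 'cV[R]_nhat).

Lemma mul_ones p (v : 'cV[R]_p) :
  ((const_mx 1 : 'cV[R]_p)^T *m v) 0 0 = \sum_i v i 0.
Proof. by rewrite mxE; apply: eq_bigr => i _; rewrite !mxE mul1r. Qed.

Lemma ones_mul p (v : 'cV[R]_1) i : ((const_mx 1 : 'cV[R]_p) *m v) i 0 = v 0 0.
Proof. by rewrite mxE big_ord1 mxE mul1r. Qed.

Lemma entry_trmul a (v : 'cV[R]_m) :
  (B^T *m v) a 0 = dotv (col a Gam) (M^T *m v).
Proof.
rewrite trmx_mul -mulmxA mxE dotvE.
by apply: eq_bigr => i _; rewrite !mxE.
Qed.

Lemma entry_trmul_abs a (v : 'cV[R]_m) : `|(B^T *m v) a 0| <= phi (M^T *m v).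
Proof.
rewrite ler_norml entry_trmul Gam_le andbT lerNl -dotvNr.
by rewrite -(is_norm_opp phi_norm); exact: Gam_le.
Qed.

Lemma hat_norm1 (x t : 'cV[R]_n) :
  lev (x - t) 0 -> lev (- x - t) 0 -> lev (en^T *m t) mu%:M -> norm1 x <= mu.
Proof.
move=> h1 h2 /(_ 0); rewrite mul_ones mxE eqxx mulr1n; apply: le_trans.
apply: ler_sum => i _; have := h1 i; have := h2 i; rewrite !mxE !subr_le0.
by rewrite ler_norml => h ->; rewrite lerNl h.
Qed.

(* Multiply the relaxed constraints at x by the weights w4. *)
Lemma hat_weak_duality (w1 w2 : 'cV[R]_n) (w3 : 'cV[R]_1) (w4 : 'cV[R]_nhat)
    (x : 'cV[R]_n) (r : R) :
  w1 + (- w2 + A^T *m (B *m w4)) = 0 -> lev (w1 + (w2 - en *m w3)) 0 ->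
  lev (ehat^T *m w4) 1%:M -> lev (- w1) 0 -> lev (- w2) 0 -> lev (- w3) 0 ->
  lev (- w4) 0 -> 0 <= r -> norm1 x <= mu -> (forall a, (B^T *m (A *m x - y)) a 0 <= r) ->
  0 <= r + (mu * w3 0 0 + dotv y (B *m w4)).
Proof.
move=> e1 h5 /(_ 0); rewrite mul_ones [X in _ <= X]mxE eqxx mulr1n => h6.
move=> h9 h10 h11 h12 r0 xmu hr.
have w40 a : 0 <= w4 a 0 by have := h12 a; rewrite !mxE oppr_le0.
have s1 : dotv (B *m w4) (A *m x - y) <= r.
  rewrite dotvC dotv_mulmx dotvC dotvE.
  apply: (@le_trans _ _ (\sum_a w4 a 0 * r)).
    by apply: ler_sum => a _; apply: ler_wpM2l.
  by rewrite -mulr_suml -[leRHS]mul1r ler_wpM2r.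
have {}e1 : A^T *m (B *m w4) = w2 - w1.
  by move/eqP: e1; rewrite addrA addrC addr_eq0 opprB => /eqP.
rewrite dotvBr dotv_mulmx e1 (dotvC _ y) in s1.
have wle i : `|(w2 - w1) i 0| <= w3 0 0.
  have := h5 i; have := h9 i; have := h10 i; rewrite !mxE big_ord1 !mxE mul1r.
  by move=> ? ? ?; rewrite ler_norml; apply/andP; split; lra.
have s2 := dotv_abs_le x wle.
have w30 : 0 <= w3 0 0 by have := h11 0; rewrite !mxE oppr_le0.
have s3 : w3 0 0 * norm1 x <= w3 0 0 * mu by rewrite ler_wpM2l.
have := ler_norm (- dotv (w2 - w1) x); rewrite normrN.
lra.
Qed.

(** Strong duality for minimising [rho] over the primal constraints provides both halves of the
    solution. *)
Lemma hat_feasible : exists z,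
  solves (Mhat1 A M Gam) (Mhat2 A M y mu Gam) (hat_rhs M y mu Gam, 0) z.
Proof.
pose G := col_mx (row_mx (1%:M : 'M[R]_n) (row_mx (- 1%:M) (0 : 'M[R]_(n, 1))))
  (col_mx (row_mx (- 1%:M : 'M[R]_n) (row_mx (- 1%:M) (0 : 'M[R]_(n, 1))))
  (col_mx (row_mx (0 : 'M[R]_(1, n)) (row_mx en^T (0 : 'M[R]_(1, 1))))
  (col_mx (row_mx (B^T *m A) (row_mx (0 : 'M[R]_(nhat, n)) (- ehat)))
  (col_mx (row_mx (0 : 'M[R]_n) (row_mx (- 1%:M) (0 : 'M[R]_(n, 1))))
          (row_mx (0 : 'M[R]_(1, n)) (row_mx (0 : 'M[R]_(1, n)) (- 1%:M : 'M[R]_1))))))).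
pose h := col_mx (0 : 'cV[R]_n) (col_mx (0 : 'cV[R]_n) (col_mx (mu%:M : 'cV[R]_1)
  (col_mx (B^T *m y) (col_mx (0 : 'cV[R]_n) (0 : 'cV[R]_1))))).
pose c := col_mx (0 : 'cV[R]_n) (col_mx (0 : 'cV[R]_n) (1%:M : 'cV[R]_1)).
have GE (x t : 'cV[R]_n) (rho : 'cV[R]_1) : G *m col_mx x (col_mx t rho) =
    col_mx (x - t) (col_mx (- x - t) (col_mx (en^T *m t)
    (col_mx (B^T *m A *m x - ehat *m rho) (col_mx (- t) (- rho))))).
  by rewrite !mul_col_mx !mul_row_col !mul0mx !mulNmx !mul1mx !(addr0, add0r).
have feasE (x t : 'cV[R]_n) (rho : 'cV[R]_1) :
    lev (G *m col_mx x (col_mx t rho)) h <->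
    [/\ lev (x - t) 0, lev (- x - t) 0, lev (en^T *m t) mu%:M,
        lev (B^T *m A *m x - ehat *m rho) (B^T *m y)
      & lev (- t) 0 /\ lev (- rho) 0].
  rewrite GE /h; split.
    by case/lev_col_mx=> ? /lev_col_mx[? /lev_col_mx[? /lev_col_mx[? /lev_col_mx[]]]].
  by case=> ? ? ? ? [? ?]; do ?[apply/lev_col_mx; split].
have cE (x t : 'cV[R]_n) (rho : 'cV[R]_1) : dotv c (col_mx x (col_mx t rho)) = rho 0 0.
  rewrite !dotv_col_mx !(dotvC 0) !dotv0r !add0r dotvE big_ord1.
  by rewrite [X in X * _]mxE eqxx mul1r.
have split3 (z : 'cV[R]_(n + (n + 1))) : exists x t rho, z = col_mx x (col_mx t rho).
  by exists (usubmx z), (usubmx (dsubmx z)), (dsubmx (dsubmx z)); rewrite !vsubmxK.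
(* The primal program is feasible at [x = 0], [t = 0] with [rho] the objective at 0, and [rho] is
   bounded below by 0. *)
have [||z [l [zh l0 Gl cz]]] := @lp_strong_duality R _ _ G h c
    (col_mx 0 (col_mx 0 (phi (M^T *m (- y)))%:M)) 0.
- apply/feasE; split; rewrite ?oppr0 ?subrr ?mulmx0 ?sub0r ?addr0 //.
  + by move=> i; rewrite [i]ord1 !mxE eqxx mulr1n ltW.
  + move=> a; set r0 := phi _.
    have -> : (- (ehat *m r0%:M)) a 0 = - r0 by rewrite mul_mx_scalar !mxE mulr1.
    have := Gam_le a (M^T *m (- y)); rewrite -/r0 -entry_trmul mulmxN [leLHS]mxE.
    by rewrite lerNl.
  + split=> // i; rewrite [i]ord1 !mxE eqxx mulr1n oppr_le0.
    exact: (is_norm_ge0 phi_norm).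
- move=> z; have [x [t [rho ->]]] := split3 z.
  case/feasE=> _ _ _ _ [_ /(_ 0)]; rewrite cE !mxE oppr_le0.
  by [].
move: zh cz; have [x [t [rho ->]]] := split3 z.
case/feasE=> z1 z2 z3 z4 [z5 z6]; rewrite cE.
rewrite -[l]vsubmxK in l0 Gl *; move: (usubmx l) (dsubmx l) l0 Gl => w1 {}l.
rewrite -[l]vsubmxK; move: (usubmx l) (dsubmx l) => w2 {}l.
rewrite -[l]vsubmxK; move: (usubmx l) (dsubmx l) => w3 {}l.
rewrite -[l]vsubmxK; move: (usubmx l) (dsubmx l) => w4 {}l.
rewrite -[l]vsubmxK; move: (usubmx l) (dsubmx l) => s r.
move=> /lev0_col_mx[l1 /lev0_col_mx[l2 /lev0_col_mx[l3 /lev0_col_mx[l4]]]].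
move=> /lev0_col_mx[l5 l6].
rewrite !tr_col_mx !tr_row_mx !mul_row_col !mul_col_mx !add_col_mx.
rewrite /c !opp_col_mx => /eq_col_mx[e1 /eq_col_mx[e2 e3]] dual.
move: e1 e2 e3; rewrite !trmxN !trmx0 !trmx1 trmx_mul !trmxK !mul0mx !mulNmx !mul1mx.
rewrite -mulmxA !(addr0, add0r) oppr0 => e1 e2 e3.
have levN p (w : 'cV[R]_p) : lev 0 w -> lev (- w) 0.
  by move=> w0 i; have := w0 i; rewrite !mxE oppr_le0.
(* The multipliers [s] and [r] of the sign constraints on [t] and [rho] are slacks: dropping them
   turns the dual equations into the inequalities of the hat system. *)
have h5 : lev (w1 + (w2 - en *m w3)) 0.
  move=> i; have := l5 i; have := congr1 (fun X : 'cV[R]_n => X i 0) e2.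
  by rewrite !mxE; lra.
have h6 : lev (ehat^T *m w4) 1%:M.
  move=> i; have := l6 i; have := congr1 (fun X : 'cV[R]_1 => X i 0) e3.
  by rewrite [i]ord1 !mxE; lra.
exists (hat_vec x t rho w1 w2 w3 w4); split.
  by apply/hat_lev; split; split=> //; do ?[split]; apply: levN.
rewrite Mhat2_hat_vec e1 -[RHS](col_mx0 _ n 1); congr col_mx.
have yE : (y^T *m (B *m w4)) 0 0 = dotv y (B *m w4) by [].
apply/colP => i; rewrite [i]ord1 mxE [X in _ + X]mxE yE [X in _ + (X + _)]mxE [RHS]mxE.
(* Equality of values: one inequality is strong duality, the other is weak duality at the primal
   part of the same vector. *)
apply/eqP; rewrite eq_le; apply/andP; split.
  move: dual; rewrite /h !dotv_col_mx !(dotvC 0) !dotv0r !add0r !addr0.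
  by rewrite -dotv_mulmx dotvE big_ord1 [X in X * _]mxE eqxx mulr1n.
apply: (hat_weak_duality e1 h5 h6 _ _ _ _ _ (hat_norm1 z1 z2 z3)); try exact: levN.
  by have := z6 0; rewrite !mxE oppr_le0.
move=> a; have := z4 a; rewrite mulmxBr mulmxA.
by rewrite !mxE big_ord1 [X in X * rho _ _]mxE; lra.
Qed.

End HatFeasibility.

(** * Test vector, relaxed solution set and the error bound *)

Lemma max_oppE {R : realDomainType} (s : R) :
  Num.max s 0 + Num.max (- s) 0 = `|s| /\ Num.max s 0 - Num.max (- s) 0 = s.
Proof.
have [s0|s0] := lerP s 0.
  have ns0 : 0 <= - s by rewrite oppr_ge0.
  by rewrite (elimT max_idPl ns0) add0r sub0r opprK ler0_norm.
have ns0 : - s <= 0 by rewrite oppr_le0 ltW.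
by rewrite (elimT max_idPr ns0) addr0 subr0 gtr0_norm.
Qed.

Section NearOptimal.
Context {R : realType} {m n q nhat : nat}.
Variables (A : 'M[R]_(m, n)) (M : 'M[R]_(m, q)) (y : 'cV[R]_m) (mu : R).
Variables (phi : 'cV[R]_q -> R) (Y : set 'cV[R]_q) (Gam : 'M[R]_(q, nhat)).
Hypothesis mu_gt0 : 0 < mu.
Hypothesis phi_norm : is_norm phi.
Hypothesis phi_basis : forall i, phi (basisv i) = 1.
Hypothesis Gam_Y : Y = range (fun a => col a Gam).
Hypothesis Y_le : forall a z, Y a -> dotv a z <= phi z.
Hypothesis Y_pos : forall i, Y (basisv i).
Hypothesis Y_neg : forall i, Y (- basisv i).

Local Notation B := (M *m Gam).
Local Notation en := (const_mx 1 : 'cV[R]_n).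
Local Notation ehat := (const_mx 1 : 'cV[R]_nhat).
Local Notation obj := (objective A M y phi).
Local Notation sigma := (robinson_sigma family_oo family_2
  (Mhat1 A M Gam) (Mhat2 A M y mu Gam)).

Lemma Gam_le a z : dotv (col a Gam) z <= phi z.
Proof. by apply: Y_le; rewrite Gam_Y; exists a. Qed.

(** Both signs of every basis vector occur among the columns of [Gam], so each coordinate of [h] is
    its modulus times one column. *)
Lemma nonneg_combination (h : 'cV[R]_q) : exists w : 'cV[R]_nhat,
  [/\ forall a, 0 <= w a 0, Gam *m w = h & \sum_a w a 0 = norm1 h].
Proof.
have [i|idx idxP] := @fin_all_exists _ _ (fun i a =>
    `|h i 0| *: col a Gam = h i 0 *: basisv i).
  have := Y_pos i; have := Y_neg i; rewrite Gam_Y => -[a _ ha] [b _ hb].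
  case: (ler0P (h i 0)) => _; last by exists b; rewrite hb.
  by exists a; rewrite ha scalerN scaleNr opprK.
exists (\sum_i `|h i 0| *: basisv (idx i)); split.
- move=> a; rewrite summxE; apply: sumr_ge0 => i _.
  by rewrite !mxE mulr_ge0.
- rewrite mulmx_sumr; apply/colP => k; rewrite summxE (bigD1 k) //= big1 => [|i ik].
    by rewrite -scalemxAr -colE idxP !mxE !eqxx mulr1 addr0.
  by rewrite -scalemxAr -colE idxP !mxE eq_sym (negbTE ik) mulr0.
under eq_bigr do rewrite summxE.
rewrite exchange_big /=; apply: eq_bigr => i _.
rewrite (bigD1 (idx i)) //= big1 => [|a ai]; first by rewrite !mxE !eqxx mulr1 addr0.
by rewrite !mxE (negbTE ai) mulr0.
Qed.

Lemma objective_ge0 x : 0 <= obj x.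
Proof. exact: (is_norm_ge0 phi_norm). Qed.

Lemma optimal_value_le x : norm1 x <= mu -> optimal_value A M y mu phi <= obj x.
Proof.
move=> xmu; apply: ge_inf; last by exists x.
by exists 0 => _ [u _ <-]; exact: objective_ge0.
Qed.

Lemma norm1_0 p : norm1 (0 : 'cV[R]_p) = 0.
Proof. by rewrite -(scale0r 0) norm1Z normr0 mul0r. Qed.

(** The value equation turns weak duality against a feasible [u] into [rho <= obj u]; hence [rho] is
    at most the optimal value, and the constraints on [x] with [rho] imply the relaxed ones. *)
Lemma hat_solution_relaxed x t rho w1 w2 w3 w4 :
  solves (Mhat1 A M Gam) (Mhat2 A M y mu Gam) (hat_rhs M y mu Gam, 0)
    (hat_vec x t rho w1 w2 w3 w4) ->
  Lambda_relaxed A M y mu phi Y x.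
Proof.
case=> /hat_lev[[h1 h2 h3 h4 h5] [h6 h7 h8 [h9 h10 h11 h12]]] /=.
rewrite Mhat2_hat_vec -[X in _ = X](col_mx0 _ n 1) => /eq_col_mx[e1 e2].
have {}e2 : rho 0 0 + (mu * w3 0 0 + dotv y (B *m w4)) = 0.
  have := congr1 (fun X : 'cV[R]_1 => X 0 0) e2.
  by rewrite [in X in X -> _]mxE [X in _ + X]mxE [X in _ + (X + _)]mxE [X in _ = X]mxE.
have rho_le : rho 0 0 <= optimal_value A M y mu phi.
  apply: lb_le_inf; first by exists (obj 0), 0 => //=; rewrite /feasible /= norm1_0 ltW.
  move=> _ [u /= umu <-].
  have hu a : (B^T *m (A *m u - y)) a 0 <= obj u.
    by rewrite entry_trmul; exact: Gam_le.
  have := hat_weak_duality e1 h5 h6 h9 h10 h11 h12 (objective_ge0 u) umu hu.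
  by rewrite -e2 lerD2r.
split; first exact: hat_norm1 h1 h2 h3.
move=> a; rewrite Gam_Y => -[i _ <-]; apply: le_trans rho_le.
rewrite -entry_trmul mulmxBr mulmxA [leLHS]mxE [X in _ + X]mxE lerBlDl.
by have := h4 i; rewrite [leLHS]mxE [X in _ + X]mxE ones_mul lerBlDr.
Qed.

Lemma hat_test_vector (k : nat) (x : 'cV[R]_n) :
  \rank A = m -> \rank M = m -> weak_RSP A k ->
  exists t rho w1 w2 w3 w4,
    let z := hat_vec x t rho w1 w2 w3 w4 in
    pos_sum (Mhat1 A M Gam *m z - hat_rhs M y mu Gam)
      + norm1 (Mhat2 A M y mu Gam *m z - 0)
    <= Num.max (norm1 x - mu) 0 + 2 * obj x
       + (`|mu - norm1 x| + 2 * best_approx1 k x) / constant_c A M.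
Proof.
move=> rA rM rsp; have [g [gle gx]] := weak_RSP_certificate x rsp.
have [h [Mh hc]] := preimage_norm1_le_c rA rM gle.
set c := constant_c A M in hc *; set zeta := A^T *m g in gle gx.
have zetaE : A^T *m g = zeta by []; clearbody zeta.
have c0 : 0 <= c := le_trans (norm1_ge0 _) hc.
have tau0 : 0 <= c^-1 by rewrite invr_ge0.
(* Scaling by [c^-1] turns [norm1 h <= c] into total mass at most 1, as the hat system demands of
   [w4]. *)
have [w4 [w40 Gw4 w4s]] := nonneg_combination (- c^-1 *: h).
have {}w4s : \sum_a w4 a 0 <= 1.
  rewrite w4s norm1Z normrN ger0_norm //; apply: le_trans (ler_wpM2l tau0 hc) _.
  (* For c = 0 the inverse is the junk value 0, and the bound still holds. *)
  by have [->|cn] := eqVneq c 0; rewrite ?mulr0 ?ler01 // mulVf.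
have Bw4 : B *m w4 = - c^-1 *: g by rewrite -mulmxA Gw4 -scalemxAr Mh.
pose t : 'cV[R]_n := \col_i `|x i 0|.
pose w1 : 'cV[R]_n := \col_i (c^-1 * Num.max (zeta i 0) 0).
pose w2 : 'cV[R]_n := \col_i (c^-1 * Num.max (- zeta i 0) 0).
exists t, (obj x)%:M, w1, w2, (c^-1)%:M, w4 => z.
have pos0 p (v d : 'cV[R]_p) : (forall i, v i 0 <= d i 0) -> pos_sum (v - d) = 0.
  move=> vd; rewrite /pos_sum big1 // => i _; apply: max_r.
  by rewrite !mxE subr_le0.
have max0 (r : R) : 0 <= Num.max r 0 by rewrite le_max lexx orbT.
(* Of the twelve blocks only the bound on the sum of [t] can be violated, by [norm1 x - mu]. *)
have -> : pos_sum (Mhat1 A M Gam *m z - hat_rhs M y mu Gam) = Num.max (norm1 x - mu) 0.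
  rewrite /z Mhat1_hat_vec /hat_rhs !opp_col_mx !add_col_mx !pos_sum_col_mx.
  rewrite [X in _ + (_ + (X + _))](_ : _ = Num.max (norm1 x - mu) 0); last first.
    rewrite /pos_sum big_ord1 [X in Num.max X _]mxE mul_ones !mxE eqxx mulr1n.
    by congr (Num.max (_ - _) _); apply: eq_bigr => i _; rewrite mxE.
  rewrite !pos0 ?add0r ?addr0 // => i.
  - rewrite !mxE oppr_le0; exact: w40.
  - by rewrite [i]ord1 !mxE eqxx mulr1n oppr_le0.
  - by rewrite !mxE oppr_le0 mulr_ge0.
  - by rewrite !mxE oppr_le0 mulr_ge0.
  - by rewrite [i]ord1 !mxE eqxx mulr1n oppr_le0 objective_ge0.
  - by rewrite !mxE oppr_le0.
  - by rewrite [i]ord1 mul_ones mxE eqxx mulr1n.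
  - rewrite !mxE big_ord1 !mxE eqxx mulr1n mul1r addrA -mulrDr subr_le0.
    rewrite -[leRHS]mulr1; apply: ler_wpM2l => //.
    by have [-> _] := max_oppE (zeta i 0).
  - rewrite [leLHS]mxE [X in _ + X]mxE ones_mul [X in _ - X]mxE eqxx mulr1n.
    rewrite lerBlDr; have := Gam_le i (M^T *m (A *m x - y)).
    by rewrite -entry_trmul mulmxBr mulmxA [leLHS]mxE [X in _ + X]mxE lerBlDl.
  - by rewrite !mxE subr_le0 -normrN ler_norm.
  - by rewrite !mxE subr_le0 ler_norm.
rewrite -addrA lerD2l subr0 /z Mhat2_hat_vec norm1_col_mx.
have -> : w1 + (- w2 + A^T *m (B *m w4)) = 0.
  apply/colP => i; rewrite Bw4 -scalemxAr zetaE !mxE addrA -mulrBr.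
  by rewrite (max_oppE _).2 mulNr subrr.
rewrite norm1_0 add0r /norm1 big_ord1.
rewrite [X in `|X|]mxE [X in `|_ + X|]mxE [X in `|_ + (X + _)|]mxE.
have -> : (y^T *m (B *m w4)) 0 0 = dotv y (B *m w4) by [].
rewrite [X in `|X + _|]mxE [X in `|_ + (mu * X + _)|]mxE eqxx !mulr1n.
(* Writing [y = A x - (A x - y)] separates the duality gap into a part governed by the certificate
   [zeta] and a part bounded by [obj x], which is how the objective comes to be counted twice. *)
have yBw : dotv y (B *m w4) = - c^-1 * dotv zeta x - dotv (B^T *m (A *m x - y)) w4.
  rewrite (dotvC _ w4) (dotv_mulmx _ w4) trmxK dotvBr (dotv_mulmx A) Bw4.
  rewrite -scalemxAr zetaE !dotvZl dotvZr (dotvC g); ring.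
have n4 : norm1 w4 <= 1.
  by apply: le_trans w4s; apply: ler_sum => a _; rewrite ger0_norm.
have h1 : `|dotv (B^T *m (A *m x - y)) w4| <= obj x.
  apply: le_trans (dotv_abs_le (B := obj x) w4 _) _.
    by move=> a; apply: entry_trmul_abs => // b v; exact: Gam_le.
  rewrite -[leRHS]mulr1.
  by apply: ler_wpM2l => //; exact: objective_ge0.
have h2 : `|mu - dotv zeta x| <= `|mu - norm1 x| + 2 * best_approx1 k x.
  have zx := dotv_abs_le x gle; rewrite mul1r in zx.
  have := ler_norm (dotv zeta x) => zx'.
  apply: (@le_trans _ _ (`|mu - norm1 x| + `|norm1 x - dotv zeta x|)).
    by apply: le_trans (ler_normD _ _); rewrite addrA subrK.
  by rewrite lerD2l ger0_norm // subr_ge0 (le_trans zx').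
rewrite yBw; apply: (@le_trans _ _ (obj x + (c^-1 * `|mu - dotv zeta x| +
    `|dotv (B^T *m (A *m x - y)) w4|))).
  set d := dotv zeta x; set e := dotv _ w4.
  have -> : obj x + (mu * c^-1 + (- c^-1 * d - e)) =
      obj x + (c^-1 * (mu - d) - e) by ring.
  apply: le_trans (ler_normD _ _) _; rewrite (ger0_norm (objective_ge0 x)) lerD2l.
  by apply: le_trans (ler_normB _ _) _; rewrite normrM (ger0_norm tau0).
have h3 := ler_wpM2l tau0 h2; rewrite [_ / c]mulrC.
by move: h1 h3; set e := `|dotv _ w4|; lra.
Qed.

Lemma objective_continuous : continuous (obj : 'cV[R]_n -> R).
Proof.
have [tri _ _] := phi_norm.
have [C C0 HC] := mulmx_norm1_bounded (M^T *m A).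
apply: (@lipschitz1_continuous _ _ _ C) => u v; rewrite lerBlDr.
apply: (@le_trans _ _ (phi (M^T *m A *m (u - v)) + obj v)); last first.
  rewrite lerD2r; apply: le_trans (HC _).
  exact: norm_le_norm1.
apply: le_trans (tri _ _); rewrite /objective -mulmxA -mulmxDr (mulmxBr A).
by rewrite addrA subrK.
Qed.

Lemma feasible_closed : closed (feasible mu : set 'cV[R]_n).
Proof.
apply/sublevel_closed/(@lipschitz1_continuous _ _ _ 1) => u v.
by rewrite mul1r lerBlDr (le_trans _ (norm1D _ _)) // subrK.
Qed.

(** The optimal set is nonempty and closed, so the distance from [z] to it is attained, and the
    Hausdorff distance dominates it. *)
Lemma Lambda_star_near (delta : R) (z : 'cV[R]_n) :
  hausdorff_dist (Lambda_star A M y mu phi) (Lambda_relaxed A M y mu phi Y) <= delta ->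
  Lambda_relaxed A M y mu phi Y z ->
  exists2 xs, optimal_solution A M y mu phi xs & norm2 (z - xs) <= delta.
Proof.
move=> hd zL; set S := Lambda_star _ _ _ _ _ in hd.
have S_opt u : S u -> optimal_solution A M y mu phi u.
  by case=> fu ou; split=> // w fw; apply: le_trans ou _; exact: optimal_value_le.
have [u0 Su0] : S !=set0.
  have [|u fu umin] := closed_bounded_min _ feasible_closed
      (fun u (fu : feasible mu u) => fu) objective_continuous.
    by exists 0; rewrite /feasible /= norm1_0 ltW.
  exists u; split=> //; apply: lb_le_inf; first by exists (obj u), u.
  by move=> _ [w fw <-]; exact: umin.
have clS : closed S.
  by apply: closedI; [exact: feasible_closed|
    apply: sublevel_closed; exact: objective_continuous].
have [u Su umin] := projection_exists z (ex_intro _ u0 Su0) clS.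
exists u; first exact: S_opt.
apply: le_trans hd; rewrite /hausdorff_dist le_max; apply/orP; right.
apply: (@le_trans _ _ (inf [set norm2 (w - z) | w in S])).
  apply: lb_le_inf; first by exists (norm2 (u - z)), u.
  by move=> _ [w Sw <-]; rewrite (norm2_distC w); exact: umin.
apply: ub_le_sup; last by exists z.
(* Both sets lie in the l1 ball of radius [mu], so the supremum in the Hausdorff distance is over a
   bounded set. *)
exists (mu + mu) => _ [w [fw _] <-]; apply: (@le_trans _ _ (norm2 (u0 - w))).
  by apply: ge_inf; [exists 0 => _ [v _ <-]; exact: norm2_ge0|exists u0].
apply: le_trans (norm2_le_norm1 _) (le_trans (norm1D _ _) _); rewrite norm1N.
by apply: lerD => //; case: Su0.
Qed.

Lemma norm2_usub_le {p r} (a : 'cV[R]_p) (b : 'cV[R]_r) :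
  norm2 a <= norm2 (col_mx a b).
Proof.
rewrite -(@ler_pXn2r _ 2) ?nnegrE ?norm2_ge0 // !norm2_sqr dotv_col_mx.
by rewrite lerDl -norm2_sqr sqr_ge0.
Qed.

Theorem near_optimal_solution (delta : R) (k : nat) (x : 'cV[R]_n) :
  \rank A = m -> \rank M = m -> weak_RSP A k ->
  hausdorff_dist (Lambda_star A M y mu phi) (Lambda_relaxed A M y mu phi Y) <= delta ->
  exists2 xs, optimal_solution A M y mu phi xs &
    norm2 (x - xs) <= delta + 2 * sigma *
      (Num.max (norm1 x - mu) 0 + 2 * obj x
       + (`|mu - norm1 x| + 2 * best_approx1 k x) / constant_c A M).
Proof.
move=> rA rM rsp hd.
have [t [rho [w1 [w2 [w3 [w4 /= zle]]]]]] := hat_test_vector x rA rM rsp.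
set z := hat_vec x t rho w1 w2 w3 w4 in zle.
have [zs zs_sol zdist] := robinson_error_bound z (hat_feasible A M y mu_gt0 phi_norm Gam_le).
move: zs_sol zdist; have [x' [t' [rho' [w1' [w2' [w3' [w4' ->]]]]]]] := hat_vec_surj zs.
move=> /hat_solution_relaxed/(Lambda_star_near hd)[xs xs_opt xs_dist] zdist.
exists xs => //; have -> : x - xs = (x - x') + (x' - xs) by rewrite addrA subrK.
apply: le_trans (norm2D _ _) _; rewrite addrC lerD //.
apply: (@le_trans _ _ (norm2 (z - hat_vec x' t' rho' w1' w2' w3' w4'))).
  rewrite /z /hat_vec opp_col_mx add_col_mx; exact: norm2_usub_le.
apply: le_trans zdist _; have s0 := robinson_sigma_ge0 (Mhat1 A M Gam) (Mhat2 A M y mu Gam).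
(* The factor 2 enters here, by doubling a nonnegative quantity. *)
apply: le_trans (ler_wpM2l s0 zle) _; rewrite -mulrA ler_peMl ?ler1n //.
rewrite mulr_ge0 //; apply: le_trans zle.
by rewrite addr_ge0 ?pos_sum_ge0 ?norm1_ge0.
Qed.

End NearOptimal.

Theorem theorem5p3 (R : realType) (m n q : nat)
    (m_gt0 : (0 < m)%N) (m_lt_n : (m < n)%N) (m_le_q : (m <= q)%N)
    (A : 'M[R]_(m, n)) (M : 'M[R]_(m, q))
    (rankA : \rank A = m) (rankM : \rank M = m)
    (y : 'cV[R]_m) (mu : R) (mu_gt0 : 0 < mu)
    (phi : 'cV[R]_q -> R) (phi_norm : is_norm phi)
    (phi_basis : forall i : 'I_q,
       phi (basisv i) = 1 /\ dual_norm phi (basisv i) = 1)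
    (chi : R) (chi_gt : expR 1 / (4 * Num.sqrt 2) < chi)
    (eps0 : R) (eps0_gt0 : 0 < eps0)
    (P : R -> set 'cV[R]_q)
    (P_barvinok : forall e, 0 < e < eps0 -> barvinok_polytope phi chi e (P e))
    (eps : nat -> R)
    (eps_range : forall k, (1 <= k)%N -> 0 < eps k < eps0)
    (eps_decr : forall k, (1 <= k)%N -> eps k.+1 < eps k)
    (eps_cvg : eps @ \oo --> (0 : R))
    (delta : R) (delta_gt0 : 0 < delta)
    (j0 : nat) (j0_ge1 : (1 <= j0)%N)
    (j0_close :
       hausdorff_dist (Lambda_star A M y mu phi)
         (Lambda_relaxed A M y mu phi (normals_Q phi P eps j0)) <= delta)
    (nhat : nat) (Gam : 'M[R]_(q, nhat))
    (Gam_normals : matrix_of_normals (normals_Q phi P eps j0) Gam)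
    (k : nat) (A_RSP : weak_RSP A k) :
  let c := constant_c A M in
  let gam := robinson_sigma family_oo family_2
               (Mhat1 A M Gam) (Mhat2 A M y mu Gam) in
  (forall x : 'cV[R]_n, exists2 xs : 'cV[R]_n,
     optimal_solution A M y mu phi xs &
     norm2 (x - xs) <= delta + 2 * gam *
       (Num.max (norm1 x - mu) 0 + 2 * phi (M^T *m (A *m x - y))
        + (`|mu - norm1 x| + 2 * best_approx1 k x) / c))
  /\
  (forall x : 'cV[R]_n, norm1 x <= mu -> exists2 xs : 'cV[R]_n,
     optimal_solution A M y mu phi xs &
     norm2 (x - xs) <= delta + 2 * gam *
       (2 * phi (M^T *m (A *m x - y))
        + (`|mu - norm1 x| + 2 * best_approx1 k x) / c)).
Proof.
move=> c gam.
have [Gam_inj Gam_Y] := Gam_normals.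
have phi1 i : phi (basisv i) = 1 by have [] := phi_basis i.
(* Facet normals and basis vectors have dual norm 1; for the opposite basis vectors the symmetry of
   [phi] is used. *)
have Y_le a z : normals_Q phi P eps j0 a -> dotv a z <= phi z.
  case=> [[l _ [_ a1]]|[i [->|->]]]; first exact: dotv_le_norm.
    by apply: dotv_le_norm => //; have [] := phi_basis i.
  rewrite dotvNl -dotvNr -(is_norm_opp phi_norm).
  by apply: dotv_le_norm => //; have [] := phi_basis i.
have Y_pos i : normals_Q phi P eps j0 (basisv i) by right; exists i; left.
have Y_neg i : normals_Q phi P eps j0 (- basisv i) by right; exists i; right.
have bound x := near_optimal_solution mu_gt0 phi_norm phi1 Gam_Y
  Y_le Y_pos Y_neg x rankA rankM A_RSP j0_close.
split=> [x|x xmu]; first exact: bound.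
have [xs xs_opt xs_le] := bound x; exists xs => //.
(* For a feasible [x] the positive part vanishes. *)
by move: xs_le; rewrite (elimT max_idPr) ?subr_le0 // add0r.
Qed.
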